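(* Let $n\ge 1$, $T>0$, $z_0\in\mathbb{R}$, $x_0,x_T\in S^n$, $v_0\in T_{x_0}S^n$, $v_T\in T_{x_T}S^n$, and let $L=L(t,x,\dot x,\omega,z)$ be a Lagrangian satisfying the standing hypotheses described in the context. Consider the following second-order Herglotz problem $(\mathcal P_V)$: among all pairs $(x,z)$ with $x\in C^4([0,T],S^n)$ and $z\in C^1([0,T],\mathbb{R})$ satisfying $$\dot z(t)=L\Bigl(t,x(t),\dot x(t),\tfrac{D^2x}{dt^2}(t),z(t)\Bigr),\quad t\in[0,T],\qquad z(0)=z_0,$$ $$x(0)=x_0,\quad x(T)=x_T,\quad \dot x(0)=v_0,\quad \dot x(T)=v_T,$$ minimize $z(T)$. If $(x,z)$ is a solution of $(\mathcal P_V)$, then, writing $\omega=\frac{D^2x}{dt^2}$ and evaluating all partial derivatives of $L$ along $(t,x(t),\dot x(t),\omega(t),z(t))$, it satisfies the generalized Euler--Lagrange equation \begin{align*} & \frac{D^2}{dt^2}\Bigl(\frac{\partial L}{\partial \omega}\Bigr)-\frac{D}{dt}\Bigl(\frac{\partial L}{\partial \dot{x}}\Bigr) -\Bigl\langle \frac{\partial L}{\partial x},x\Bigr\rangle x-\langle \ddot{x},x\rangle \frac{\partial L}{\partial \omega}-2 \Bigl\langle \frac{\partial L}{\partial \omega}, \dot{x} \Bigr\rangle \dot{x}- 2 \Bigl\langle \frac{\partial L}{\partial \omega}, x \Bigr\rangle \ddot{x} \\ & +\frac{\partial L}{\partial x}-\Bigl\langle \frac{d}{dt}\Bigl(\frac{\partial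 L}{\partial \omega}\Bigr),x\Bigr\rangle \dot{x}+3\Bigl\langle \frac{\partial L}{\partial \omega},x\Bigr\rangle\langle\ddot{x},x\rangle x +\Bigl(\frac{\partial L}{\partial z}\Bigr)^2 \Bigl( \frac{\partial L}{\partial \omega}-\Bigl\langle \frac{\partial L}{\partial \omega},x\Bigr\rangle x\Bigr)\\ &-\frac{D}{dt}\Bigl(\frac{\partial L}{\partial z} \frac{\partial L}{\partial \omega}\Bigr) -\frac{\partial L}{\partial z} \Bigl[ \frac{D}{dt}\Bigl(\frac{\partial L}{\partial \omega}\Bigr)- \frac{\partial L}{\partial \dot{x}} +\Bigl\langle \frac{\partial L}{\partial \dot{x}} ,x\Bigr\rangle x - 2 \Bigl\langle\frac{\partial L}{\partial \omega},x\Bigr\rangle \dot{x}\Bigr] =0. \end{align*}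
   Context: $\langle\cdot,\cdot\rangle$ is the standard inner product of $\mathbb{R}^{n+1}$; $S^n=\{p\in\mathbb{R}^{n+1}:\langle p,p\rangle=1\}$; $T_pS^n=\{v\in\mathbb{R}^{n+1}:\langle v,p\rangle=0\}$. Curves in $S^n$ are regarded as curves in $\mathbb{R}^{n+1}$, and dots denote ordinary derivatives in $\mathbb{R}^{n+1}$. For an $\mathbb{R}^{n+1}$-valued function $Y$ along a curve $x$ in $S^n$, $\frac{DY}{dt}=\dot Y-\langle\dot Y,x\rangle x$ and $\frac{D^2Y}{dt^2}=\frac{D}{dt}\bigl(\frac{DY}{dt}\bigr)$. The covariant acceleration of $x$ is $\frac{D^2x}{dt^2}=\frac{D\dot x}{dt}=\ddot x-\langle\ddot x,x\rangle x$. Standing hypotheses on $L$: the second-order tangent bundle $T^2S^n$ is identified with triples $(p,v,u)$, $p\in S^n$, $v,u\in T_pS^n$, and $L\in C^1([0,T]\times T^2S^n\times\mathbb{R},\mathbb{R})$; viewing the problem as a constrained problem in $\mathbb{R}^{n+1}$ with constraint $\langle x(t),x(t)\rangle=1$, $L$ is regarded as a function in $C^1([0,T]\times\mathbb{R}^{3n+3}\times\mathbb{R},\mathbb{R})$. The symbols $\frac{\partial L}{\partial x},\frac{\partial L}{\partial\dot x},\frac{\partial L}{\partial\omega}$ denote the partial derivatives (gradients in $\mathbb{R}^{n+1}$) with respect to the second, third and fourth arguments, and $\frac{\partial L}{\partial z}$ is the partial derivative with respect to the last argument. For any admissible trajectory $(x,z)$, with $\omega=\frac{D^2x}{dt^2}$,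 the four functions $t\mapsto\frac{\partial L}{\partial x},\ \frac{\partial L}{\partial\dot x},\ \frac{\partial L}{\partial\omega},\ \frac{\partial L}{\partial z}$ evaluated at $(t,x(t),\dot x(t),\omega(t),z(t))$ are differentiable. *)

(* Defs.v *)
From HB Require Import structures.
From mathcomp Require Import all_boot all_order all_algebra.
From mathcomp Require Import all_classical all_reals all_analysis.
Set Implicit Arguments.
Unset Strict Implicit.
Unset Printing Implicit Defensive.
Import Order.TTheory GRing.Theory Num.Theory.
Import numFieldNormedType.Exports.
Local Open Scope classical_set_scope.
Local Open Scope ring_scope.

Section CalculusOnASet.
Context {R : realType} {V : normedModType R}.
Implicit Types (A : set R) (f : R -> V) (t : R).

(* Derivatives of curves are taken along a set of times [A]; for [A = [0, T]]
   they are the usual derivatives inside and one-sided at the end points, and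
   only the values of [f] on [A] matter. *)
Definition dquot f t (s : R) : V := (s - t)^-1 *: (f s - f t).

Definition derivable_along A f t : Prop :=
  cvg (dquot f t s @[s --> within A t^']).

Definition derive_along A f t : V :=
  lim (dquot f t s @[s --> within A t^']).

Definition deriven_along A (k : nat) f : R -> V := iter k (derive_along A) f.

Definition Ck_along A (k : nat) f : Prop :=
  (forall j t, (j < k)%N -> A t -> derivable_along A (deriven_along A j f) t) /\
  {within A, continuous (deriven_along A k f)}.

End CalculusOnASet.

Section SphereGeometry.
Context {R : realType} {n : nat}.
Notation E := 'rV[R]_n.+1.
Implicit Types (p u v : E) (x Y : R -> E).

(* The library's norm on row vectors is the sup norm, not the one induced by
   this inner product; only its topology is used here. *)
Definition dotp u v : R := \sum_i u ord0 i * v ord0 i.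

Definition sphere : set E := [set p | dotp p p = 1].

Definition tangent p : set E := [set v | dotp v p = 0].

Definition covD (A : set R) x Y (t : R) : E :=
  derive_along A Y t - dotp (derive_along A Y t) (x t) *: x t.

(* Agrees with [covD A x x] differentiated again: for a curve on the sphere
   the velocity is tangent, so [covD A x x] is the velocity itself. *)
Definition covacc (A : set R) x : R -> E := covD A x (derive_along A x).

Definition derivable_coord (f : E -> R) p : Prop :=
  forall i, derivable f p (delta_mx ord0 i).

Definition grad (f : E -> R) p : E :=
  \row_i 'D_(delta_mx ord0 i) f p.

End SphereGeometry.

Section HerglotzProblem.
Context {R : realType} {n : nat}.
Notation E := 'rV[R]_n.+1.

Definition lagrangian := R -> E -> E -> E -> R -> R.

Implicit Types (L : lagrangian) (t z : R) (x v w : E).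

Definition L_t (T : R) L t x v w z : R :=
  derive_along `[0, T] (fun s => L s x v w z) t.
Definition L_x L t x v w z : E := grad (fun y => L t y v w z) x.
Definition L_v L t x v w z : E := grad (fun y => L t x y w z) v.
Definition L_w L t x v w z : E := grad (fun y => L t x v y z) w.
Definition L_z L t x v w z : R := derive1 (fun s => L t x v w s) z.

Definition uncurry5 {V : Type} (F : R -> E -> E -> E -> R -> V) :
    R * E * E * E * R -> V :=
  fun q => F q.1.1.1.1 q.1.1.1.2 q.1.1.2 q.1.2 q.2.

Definition slab (T : R) : set (R * E * E * E * R) :=
  [set q | `[0, T]%classic q.1.1.1.1].

(* Class C^1 on the slab: [L] is continuous and all its first-order partial
   derivatives (one-sided in time at 0 and T) exist and are continuous. *)
Record C1_lagrangian (T : R) L : Prop := {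
  C1_ex_t : forall t x v w z, `[0, T]%classic t ->
    derivable_along `[0, T] (fun s => L s x v w z) t;
  C1_ex_x : forall t x v w z, `[0, T]%classic t ->
    derivable_coord (fun y => L t y v w z) x;
  C1_ex_v : forall t x v w z, `[0, T]%classic t ->
    derivable_coord (fun y => L t x y w z) v;
  C1_ex_w : forall t x v w z, `[0, T]%classic t ->
    derivable_coord (fun y => L t x v y z) w;
  C1_ex_z : forall t x v w z, `[0, T]%classic t ->
    derivable (fun s => L t x v w s) z 1;
  C1_cont : {within slab T, continuous (uncurry5 L)};
  C1_cont_t : {within slab T, continuous (uncurry5 (L_t T L))};
  C1_cont_x : {within slab T, continuous (uncurry5 (L_x L))};
  C1_cont_v : {within slab T, continuous (uncurry5 (L_v L))};
  C1_cont_w : {within slab T, continuous (uncurry5 (L_w L))};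
  C1_cont_z : {within slab T, continuous (uncurry5 (L_z L))}
}.

(* [F] evaluated at (t, x(t), x'(t), D^2x/dt^2(t), z(t)). *)
Definition along {V : Type} (T : R) (F : R -> E -> E -> E -> R -> V)
    (x : R -> E) (z : R -> R) (t : R) : V :=
  F t (x t) (derive_along `[0, T] x t) (covacc `[0, T] x t) (z t).

Record admissible (T : R) L (z0 : R) (x0 xT v0 vT : E)
    (x : R -> E) (z : R -> R) : Prop := {
  adm_C4 : Ck_along `[0, T] 4 x;
  adm_sphere : forall t, `[0, T]%classic t -> sphere (x t);
  adm_C1 : Ck_along `[0, T] 1 z;
  adm_ode : forall t, `[0, T]%classic t ->
    derive_along `[0, T] z t = along T L x z t;
  adm_z0 : z 0 = z0;
  adm_x0 : x 0 = x0;
  adm_xT : x T = xT;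
  adm_v0 : derive_along `[0, T] x 0 = v0;
  adm_vT : derive_along `[0, T] x T = vT
}.

(* Curves are total functions on R of which only the restriction to [0, T] is
   constrained or used. *)
Definition herglotz_solution (T : R) L (z0 : R) (x0 xT v0 vT : E)
    (x : R -> E) (z : R -> R) : Prop :=
  admissible T L z0 x0 xT v0 vT x z /\
  forall y s, admissible T L z0 x0 xT v0 vT y s -> z T <= s T.

Definition partials_derivable_along (T : R) L (x : R -> E) (z : R -> R) : Prop :=
  forall t, `[0, T]%classic t ->
  [/\ derivable_along `[0, T] (along T (L_x L) x z) t,
      derivable_along `[0, T] (along T (L_v L) x z) t,
      derivable_along `[0, T] (along T (L_w L) x z) t &
      derivable_along `[0, T] (along T (L_z L) x z) t].

Definition standing_hypotheses (T : R) L (z0 : R) (x0 xT v0 vT : E) : Prop :=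
  C1_lagrangian T L /\
  forall (x : R -> E) (z : R -> R), admissible T L z0 x0 xT v0 vT x z ->
    partials_derivable_along T L x z.

End HerglotzProblem.

Arguments lagrangian : clear implicits.

(* Main.v *)
(* The curve x is varied on the sphere by rotations R(eps phi(t)) x(t) in a fixed
   coordinate plane (i, j), with phi, phi' vanishing at the end points; the
   perturbed z solves a scalar ODE, and Gronwall-type bounds with an integrating
   factor lam (lam' = - (dL/dz) lam) show that z_eps(T) - z(T) is
   eps N(T) / lam(T) + o(eps), where N(T) is the integral of
   A phi + B phi' + C phi''.  Minimality forces N(T) = 0, and the second-order
   lemma of du Bois-Reymond, for merely continuous A, B and C, gives
   C' = B - A1 with A1' = A.  Writing [u, w] for u_i w_j - u_j w_i, one has
   C = lam [dL/dw, x], so this makes every [d/dt dL/dw, x] differentiable and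
   computes its derivative; as i and j vary these brackets determine the tangential
   part of the Euler-Lagrange expression, whose normal part vanishes identically. *)
Require Import Defs.
From HB Require Import structures.
From mathcomp Require Import all_boot all_order all_algebra.
From mathcomp Require Import all_classical all_reals all_analysis.
From mathcomp Require Import ring lra.
Set Implicit Arguments.
Unset Strict Implicit.
Unset Printing Implicit Defensive.
Import Order.TTheory GRing.Theory Num.Theory.
Import numFieldNormedType.Exports.
Local Open Scope classical_set_scope.
Local Open Scope ring_scope.

(** * Calculus of derivatives along a set of times, in relational form *)

Section HasDeriv.
Context {R : realType} {V : normedModType R}.
Implicit Types (A : set R) (f g : R -> V) (t : R).

(** The hypotheses make [dL/dw] differentiable once along the solution, while the equation contains
    its second covariant derivative. Rotations keep the varied curve exactly on the sphere, and they
    move it by exactly [eps *: Q] with [Q] jointly continuous in [eps] and [t]; the value of [Q] at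
    [eps = 0] is the direction of variation, and nothing is differentiated in [eps]. A rational
    parametrization leaves C^4 regularity to sums, products and inverses. Test functions must be of
    class C^4, as the competitors are, hence four primitives and the matching of four derivatives at
    [T] in the du Bois-Reymond lemma. Each competitor also needs a [z] on all of [0, T]: a truncated
    equation is solved globally, and its solution turns out small enough to avoid the truncation. *)

Definition has_deriv A f t (d : V) : Prop :=
  dquot f t s @[s --> within A t^'] --> d.

Lemma has_deriv_eq A f t d d' : has_deriv A f t d -> d = d' -> has_deriv A f t d'.
Proof. by move=> h <-. Qed.

Lemma dnbhs_within_in A t : \forall s \near within A t^', A s /\ s != t.
Proof.
by apply: (@filterE _ (nbhs t)) => s st As; split.
Qed.

Lemma has_deriv_ext A f g t d : A t -> {in A, f =1 g} ->
  has_deriv A f t d -> has_deriv A g t d.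
Proof.
move=> At fg; apply: cvg_trans; apply: near_eq_cvg.
near=> s; rewrite /dquot !fg ?inE//.
by have [] : A s /\ s != t by near: s; exact: dnbhs_within_in.
Unshelve. all: by end_near. Qed.

End HasDeriv.

Section HasDerivScalar.
Context {R : realType}.
Implicit Types (A : set R) (f g : R -> R) (t : R).

Lemma has_deriv_cst A (k : R) t : has_deriv A (fun=> k) t 0.
Proof.
rewrite /has_deriv; apply: cvg_near_cst; near=> s.
by rewrite /dquot subrr scaler0.
Unshelve. all: by end_near. Qed.

Lemma has_deriv_id A t : has_deriv A id t 1.
Proof.
apply: cvg_near_cst; near=> s; rewrite /dquot.
have [_ st] : A s /\ s != t by near: s; exact: dnbhs_within_in.
by rewrite /GRing.scale/= mulVf// subr_eq0.
Unshelve. all: by end_near. Qed.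

Lemma has_derivD A f g t df dg : has_deriv A f t df -> has_deriv A g t dg ->
  has_deriv A (fun s => f s + g s) t (df + dg).
Proof.
move=> hf hg; rewrite /has_deriv.
rewrite (_ : dquot _ t = fun s => dquot f t s + dquot g t s).
  exact: cvgD.
by apply/funext => s; rewrite /dquot -scalerDr; congr (_ *: _); ring.
Qed.

Lemma has_deriv_cvg A f t df : has_deriv A f t df ->
  f s @[s --> within A t^'] --> f t.
Proof.
move=> hf.
have h : (s - t) * dquot f t s + f t @[s --> within A t^'] --> 0 * df + f t.
  apply: cvgD; last exact: cvg_cst.
  apply: cvgM => //; rewrite -(subrr t).
  apply: cvgB; last exact: cvg_cst.
  apply: (cvg_trans (G := t^')); last exact: cvg_within.
  exact: cvg_within.
rewrite mul0r add0r in h; apply: cvg_trans h; apply: near_eq_cvg.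
near=> s.
have [_ st] : A s /\ s != t by near: s; exact: dnbhs_within_in.
rewrite /dquot /GRing.scale/= mulrA divff ?subr_eq0// mul1r; ring.
Unshelve. all: by end_near. Qed.

Lemma has_derivM A f g t df dg : has_deriv A f t df -> has_deriv A g t dg ->
  has_deriv A (fun s => f s * g s) t (df * g t + f t * dg).
Proof.
move=> hf hg; rewrite /has_deriv.
rewrite (_ : dquot _ t = fun s => dquot f t s * g s + f t * dquot g t s).
  apply: cvgD; apply: cvgM => //; [exact: has_deriv_cvg hg|exact: cvg_cst].
by apply/funext => s; rewrite /dquot /GRing.scale/=; ring.
Qed.

Lemma has_derivN A f t df : has_deriv A f t df ->
  has_deriv A (fun s => - f s) t (- df).
Proof.
move=> hf; rewrite /has_deriv.
rewrite (_ : dquot _ t = fun s => - dquot f t s); first exact: cvgN.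
by apply/funext => s; rewrite /dquot -scalerN; congr (_ *: _); ring.
Qed.

Lemma has_derivB A f g t df dg : has_deriv A f t df -> has_deriv A g t dg ->
  has_deriv A (fun s => f s - g s) t (df - dg).
Proof. by move=> hf hg; apply: has_derivD => //; exact: has_derivN. Qed.

Lemma has_derivZ A f (k : R) t df : has_deriv A f t df ->
  has_deriv A (fun s => k * f s) t (k * df).
Proof.
move=> hf; apply: has_deriv_eq (has_derivM (has_deriv_cst A k t) hf) _.
by rewrite mul0r add0r.
Qed.

Lemma has_derivV A f t df : A t -> {in A, forall s, f s != 0} ->
  has_deriv A f t df -> has_deriv A (fun s => (f s)^-1) t (- df / f t ^+ 2).
Proof.
move=> At f0 hf; have ft0 : f t != 0 by apply: f0; rewrite inE.
have h : - (dquot f t s * ((f s)^-1 * (f t)^-1)) @[s --> within A t^']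
    --> - (df * ((f t)^-1 * (f t)^-1)).
  apply: cvgN; apply: cvgM => //; apply: cvgM; last exact: cvg_cst.
  by apply: cvgV => //; exact: has_deriv_cvg hf.
rewrite (_ : - df / f t ^+ 2 = - (df * ((f t)^-1 * (f t)^-1))); last first.
  by rewrite expr2 invfM mulNr.
apply: cvg_trans h; apply: near_eq_cvg; near=> s.
have [As st] : A s /\ s != t by near: s; exact: dnbhs_within_in.
have fs0 : f s != 0 by apply: f0; rewrite inE.
rewrite /dquot /GRing.scale/=.
by field; rewrite fs0 ft0 subr_eq0 st.
Unshelve. all: by end_near. Qed.

Lemma has_deriv_sum A (J : finType) (F : J -> R -> R) (dF : J -> R) t :
  (forall j, has_deriv A (F j) t (dF j)) ->
  has_deriv A (fun s => \sum_j F j s) t (\sum_j dF j).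
Proof.
move=> hF; rewrite unlock /reducebig.
elim: (index_enum J) => [|j r ih] /=; first exact: has_deriv_cst.
exact: has_derivD.
Qed.

Lemma is_derive_has_deriv A f t d : is_derive t 1 f d -> has_deriv A f t d.
Proof.
move=> [/cvg_ex[/= l hl]]; rewrite /derive (cvg_lim _ hl)// => <-.
suff : dquot f t s @[s --> t^'] --> l.
  by apply: cvg_trans; apply: cvg_app; exact: cvg_within.
apply/cvgrPdist_lt => e e0.
move/cvgrPdist_lt : hl => /(_ _ e0) [d0 /= d00 hd].
exists d0 => //= s; rewrite /= => sd st.
have := hd (s - t); rewrite /= sub0r normrN distrC => /(_ sd).
rewrite subr_eq0 => /(_ st); rewrite /dquot.
by rewrite [_ *: 1]mulr1 subrK.
Qed.

End HasDerivScalar.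

(** * Calculus on [0, T]: uniqueness of derivatives, comparison, primitives *)

Section Clamp.
Context {R : realType}.
Variables (T : R) (T0 : 0 < T).
Local Notation I := (`[0, T]%classic : set R).

(* Composing with [clamp] turns continuity on [0, T] into continuity on [R]. *)
Definition clamp (t : R) : R := Num.max 0 (Num.min t T).

Lemma clamp_in t : I (clamp t).
Proof.
rewrite /= in_itv/= /clamp le_max lexx/= ge_max (ltW T0)/=.
by rewrite ge_min lexx orbT.
Qed.

Lemma clamp_id t : I t -> clamp t = t.
Proof.
rewrite /= in_itv/= => /andP[t0 tT].
by rewrite /clamp (min_l tT) (max_r t0).
Qed.

Lemma clamp_continuous : continuous clamp.
Proof.
move=> t; apply: (@continuous_max R R (fun=> 0) (fun s : R => Num.min s T)).
  exact: cvg_cst.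
by apply: (@continuous_min R R id (fun=> T)); [exact: cvg_id|exact: cvg_cst].
Qed.

Lemma seg_bounds t : I t -> 0 <= t /\ t <= T.
Proof. by rewrite /= in_itv/= => /andP. Qed.

Lemma itv0 : I 0. Proof. by rewrite /= in_itv/= lexx ltW. Qed.
Lemma itvT : I T. Proof. by rewrite /= in_itv/= lexx ltW. Qed.

(** No point of [0, T] is isolated in it: step to the right when [t < T], to the left at [T]. This
    is what makes limits of difference quotients along [0, T] unique, end points included. *)
Lemma dnbhs_segment_proper t : I t -> ProperFilter (within I t^').
Proof.
rewrite /= in_itv/= => /andP[t0 tT].
apply: Build_ProperFilter_ex => B [e /= e0 eB].
have [tT'|tT'] := ltP t T.
  have m0 : 0 < Num.min (e / 2) (T - t) by rewrite lt_min divr_gt0//= subr_gt0.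
  exists (t + Num.min (e / 2) (T - t)); apply: eB => /=.
  - rewrite opprD addNKr normrN gtr0_norm// gt_min; apply/orP; left; lra.
  - by rewrite -subr_eq0 addrAC subrr add0r gt_eqF.
  - have : Num.min (e / 2) (T - t) <= T - t by rewrite ge_min lexx orbT.
    by move=> mT; rewrite in_itv/=; apply/andP; split; lra.
have m0 : 0 < Num.min (e / 2) T by rewrite lt_min divr_gt0.
exists (t - Num.min (e / 2) T); apply: eB => /=.
- rewrite opprB addrCA subrr addr0 gtr0_norm// gt_min; apply/orP; left; lra.
- by rewrite -subr_eq0 addrAC subrr add0r oppr_eq0 gt_eqF.
- have : Num.min (e / 2) T <= T by rewrite ge_min lexx orbT.
  by move=> mT; rewrite in_itv/=; apply/andP; split; lra.
Qed.

Section Vector.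
Context {V : normedModType R}.
Implicit Types (f : R -> V).

Lemma has_deriv_derive f t d : I t -> has_deriv I f t d -> derive_along I f t = d.
Proof.
by move=> It h; have := dnbhs_segment_proper It; move=> ?; exact: cvg_lim h.
Qed.

Lemma has_deriv_derivable A f t d : has_deriv A f t d -> derivable_along A f t.
Proof. by move=> h; apply/cvg_ex; exists d. Qed.

Lemma derivable_has_deriv f t : I t -> derivable_along I f t ->
  has_deriv I f t (derive_along I f t).
Proof.
by move=> It /cvg_ex[l h]; rewrite (has_deriv_derive It h).
Qed.

End Vector.

Lemma has_deriv_uniq (V : normedModType R) (f : R -> V) t d d' :
  I t -> has_deriv I f t d -> has_deriv I f t d' -> d = d'.
Proof. by move=> It /(has_deriv_derive It) <- /(has_deriv_derive It). Qed.

(** Continuity relative to [A] becomes plain continuity once the inner map takes its values in [A];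
    the typical inner map is [clamp]. *)
Lemma within_continuous_comp (X Y Z : topologicalType) (A : set Y) (f : Y -> Z)
    (g : X -> Y) p : {within A, continuous f} -> (forall q, A (g q)) ->
  {for p, continuous g} -> {for p, continuous (fun q => f (g q))}.
Proof.
move=> /subspace_continuousP cf gA cg B fB.
have := cg _ (cf _ (gA p) _ fB) => /=; rewrite /= !nbhs_simpl /=.
by apply: filterS => q; apply.
Qed.

Lemma has_deriv_continuous (f df : R -> R) :
  (forall t, I t -> has_deriv I f t (df t)) -> {within I, continuous f}.
Proof.
move=> h; apply/subspace_continuousP => t It B fB.
have H : nbhs t (fun s => s != t -> I s -> B (f s)).
  exact: has_deriv_cvg (h t It) _ fB.
suff: nbhs t (fun s => I s -> B (f s)) by [].
apply: filterS H => s sB Is; have [->|st] := eqVneq s t; last exact: sB.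
exact: (nbhs_singleton fB).
Qed.

(** At interior points [0, T] is a neighbourhood, so the derivative along it is two-sided. Interior
    points are all that the mean value theorem asks for. *)
Lemma has_deriv_is_derive (f : R -> R) t d : 0 < t -> t < T ->
  has_deriv I f t d -> is_derive t 1 f d.
Proof.
move=> t0 tT h; have h' : dquot f t s @[s --> t^'] --> d.
  move=> B dB; have hB : nbhs t (fun s => s != t -> I s -> B (dquot f t s)) by exact: h.
  have It : \forall s \near t, I s.
    have : t \in `]0, T[%R by rewrite in_itv/= t0 tT.
    move=> /near_in_itvoo; apply: filterS => s.
    by rewrite /= !in_itv/= => /andP[s0 sT]; rewrite !ltW.
  suff: nbhs t (fun s => s != t -> B (dquot f t s)) by [].
  by apply: filterS2 hB It => s sB Is st; exact: sB.
have hd : h^-1 *: (f (h *: 1 + t) - f t) @[h --> 0^'] --> d.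
  apply/cvgrPdist_lt => e e0.
  move/cvgrPdist_lt : h' => /(_ _ e0) [d0 /= d00 hd].
  exists d0 => //= s; rewrite /= sub0r normrN => sd s0.
  have := hd (s + t); rewrite /= opprD addrCA subrr addr0 normrN => /(_ sd).
  have st : s + t != t by rewrite -subr_eq0 addrK.
  by move=> /(_ st); rewrite /dquot addrK [_ *: 1]mulr1.
apply: DeriveDef; first by apply/cvg_ex; exists d.
exact: cvg_lim hd.
Qed.

Lemma has_deriv_nondecr (f df : R -> R) a b :
  (forall t, I t -> has_deriv I f t (df t)) -> (forall t, I t -> 0 <= df t) ->
  0 <= a -> a <= b -> b <= T -> f a <= f b.
Proof.
move=> hf df0 a0 ab bT.
have [||c] := @MVT_segment R f df a b ab.
- move=> s; rewrite in_itv/= => /andP[sa sb].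
  apply: has_deriv_is_derive; [lra|lra|apply: hf].
  by rewrite /= in_itv/=; apply/andP; split; lra.
- apply: continuous_subspaceW (has_deriv_continuous hf) => s /=.
  by rewrite !in_itv/= => /andP[sa sb]; apply/andP; split; lra.
rewrite in_itv/= => /andP[ca cb] E; rewrite -subr_ge0 E mulr_ge0 ?subr_ge0//.
by apply: df0; rewrite /= in_itv/=; apply/andP; split; lra.
Qed.

(** Both [g - f] and [g + f] are nondecreasing. This replaces integral estimates: each later use
    supplies an explicit majorant [g]. *)
Lemma has_deriv_le (f df g dg : R -> R) a b :
  (forall t, I t -> has_deriv I f t (df t)) ->
  (forall t, I t -> has_deriv I g t (dg t)) ->
  (forall t, I t -> `|df t| <= dg t) ->
  0 <= a -> a <= b -> b <= T -> `|f b - f a| <= g b - g a.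
Proof.
move=> hf hg fg a0 ab bT.
have h1 : g a - f a <= g b - f b.
  apply: (@has_deriv_nondecr (fun s => g s - f s) (fun s => dg s - df s)) => // t It.
    by apply: has_derivB; [exact: hg|exact: hf].
  by rewrite subr_ge0 (le_trans _ (fg t It))// ler_norm.
have h2 : g a + f a <= g b + f b.
  apply: (@has_deriv_nondecr (fun s => g s + f s) (fun s => dg s + df s)) => // t It.
    by apply: has_derivD; [exact: hg|exact: hf].
  by have := fg t It; rewrite ler_norml => /andP[? ?]; lra.
by rewrite ler_norml; apply/andP; split; lra.
Qed.

Lemma primitive_is_derive (f : R -> R) : continuous f ->
  exists F : R -> R, F 0 = 0 /\ forall t, I t -> is_derive t 1 F (f t).
Proof.
move=> cf; pose mu := @lebesgue_measure R.
(* Integrating from -1 makes every point of [0, T] interior to [-1, T + 1], so the fundamental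
   theorem gives two-sided derivatives at 0 and [T] as well. *)
pose G x := (\int[mu]_(t in `[(-1), x]) f t)%R.
exists (fun x => G x - G 0); split; first by rewrite subrr.
move=> t; rewrite /= in_itv/= => /andP[t0 tT].
have t1 : t < T + 1 by lra.
have fi : mu.-integrable `[(-1), (T + 1)] (EFin \o f).
  apply: continuous_compact_integrable; first exact: segment_compact.
  exact: continuous_subspaceT.
have t2 : -1 < t by lra.
have [dG G'] := continuous_FTC1_closed t1 fi t2 (cf t).
have hG : is_derive t 1 G (f t) by split; [exact: dG|rewrite -derive1E; exact: G'].
by apply: is_derive_eq; rewrite subr0.
Qed.

Lemma primitive (f : R -> R) : continuous f ->
  exists F : R -> R, F 0 = 0 /\ forall t, I t -> has_deriv I F t (f t).
Proof.
move=> /primitive_is_derive [F [F0 dF]]; exists F; split => // t It.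
by apply: is_derive_has_deriv; exact: dF.
Qed.

Lemma integrating_factor (f : R -> R) : continuous f ->
  exists lam : R -> R, (forall t, 0 < lam t) /\
    forall t, I t -> has_deriv I lam t (f t * lam t).
Proof.
move=> /primitive_is_derive [F [_ dF]]; exists (fun t => expR (F t)); split.
  by move=> t; exact: expR_gt0.
move=> t It; apply: is_derive_has_deriv; have := dF t It => dFt.
by apply: is_derive_eq; rewrite /GRing.scale/= mulrC.
Qed.

End Clamp.

Section ContinuousAt.
Context {X Y Z : topologicalType}.

Lemma continuous_at_pair (f : X -> Y) (g : X -> Z) x : {for x, continuous f} ->
  {for x, continuous g} -> {for x, continuous (fun q => (f q, g q))}.
Proof.
move=> cf cg; rewrite /prop_for /continuous_at /=.
have : (f q, g q) @[q --> x] --> (f x, g x) by apply: cvg_pair.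
exact.
Qed.

Lemma continuous_at_comp (f : X -> Y) (g : Y -> Z) x : {for x, continuous f} ->
  {for f x, continuous g} -> {for x, continuous (fun q => g (f q))}.
Proof. by move=> cf cg; exact: (continuous_comp cf cg). Qed.

End ContinuousAt.

(** * Global solution of a Lipschitz scalar ODE by Picard iteration *)

Section GeometricLimit.
Context {R : realType}.

Lemma geometric_small (M e : R) : 0 < e -> exists k : nat, M * 2^-1 ^+ k < e.
Proof.
move=> e0.
have h : M * 2^-1 ^+ k @[k --> \oo] --> M * 0.
  apply: cvgM; first exact: cvg_cst.
  by apply: cvg_expr; rewrite gtr0_norm ?invr_gt0// invf_lt1//; lra.
move: h; rewrite mulr0 => /cvgrPdist_lt /(_ _ e0).
move=> /filter_ex[k]; rewrite sub0r normrN => hk.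
by exists k; rewrite (le_lt_trans _ hk)// ler_norm.
Qed.

(* The limit is the sup of the nondecreasing sequence [v k - 2 C 2^-k], which lies
   below the nonincreasing sequence [v k + 2 C 2^-k]. *)
Lemma geometric_limit (v : nat -> R) (C : R) :
  (forall k, `|v k.+1 - v k| <= C * 2^-1 ^+ k) ->
  exists l, forall k, `|l - v k| <= 2 * C * 2^-1 ^+ k.
Proof.
move=> hv; pose b k := v k - 2 * C * 2^-1 ^+ k.
pose a k := v k + 2 * C * 2^-1 ^+ k.
have C0 : 0 <= C by have := hv 0%N; rewrite expr0 mulr1; apply: le_trans.
have bS k : b k <= b k.+1.
  by have := hv k; rewrite ler_norml /b exprS => /andP[? ?]; lra.
have aS k : a k.+1 <= a k.
  by have := hv k; rewrite ler_norml /a exprS => /andP[? ?]; lra.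
have ba k : b k <= a k.
  have : 0 <= C * 2^-1 ^+ k by rewrite mulr_ge0// exprn_ge0// invr_ge0.
  by rewrite /b /a; lra.
have bD k j : b k <= b (k + j)%N.
  by elim: j => [|j ih]; rewrite ?addn0// addnS (le_trans ih).
have aD k j : a (k + j)%N <= a k.
  by elim: j => [|j ih]; rewrite ?addn0// addnS (le_trans _ ih).
have bak k j : b j <= a k.
  apply: le_trans (aD k j); apply: le_trans (ba _).
  by rewrite addnC; exact: bD.
have ub k : ubound (range b) (a k) by move=> _ [j _ <-].
exists (sup (range b)) => k.
have bs : b k <= sup (range b).
  by apply: ub_le_sup; [exists (a 0%N); exact: ub|exists k].
have sa : sup (range b) <= a k.
  by apply: ge_sup; [exists (b 0%N), 0%N|exact: ub].
by rewrite ler_norml; move: bs sa; rewrite /a /b => ? ?; apply/andP; split; lra.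
Qed.

End GeometricLimit.

Section Picard.
Context {R : realType}.
Variables (T : R) (T0 : 0 < T).
Local Notation I := (`[0, T]%classic : set R).
Local Notation cl := (clamp T).

Lemma has_deriv_expR (k t : R) (A : set R) :
  has_deriv A (fun s => expR (k * s)) t (k * expR (k * t)).
Proof.
apply: is_derive_has_deriv; apply: is_derive_eq.
by rewrite /GRing.scale/= mulr1 mulrC.
Qed.

Lemma clamped_continuous (f : R -> R) : {within I, continuous f} ->
  continuous (fun t => f (cl t)).
Proof.
move=> cf t; apply: (within_continuous_comp cf); first exact: clamp_in.
exact: clamp_continuous.
Qed.

(** Distances are weighted by [expR (2 * K * t)]: integrating [K] times this weight halves it, so
    each iteration contracts by 1/2 on the whole of [0, T], however long. The first iterate is
    dominated by [c] times the weight because [1 <= K], and summing the geometric series gives the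
    final bound. *)
Lemma picard (f : R -> R -> R) (K c : R) : 1 <= K -> 0 <= c ->
  continuous (fun p : R * R => f p.1 p.2) ->
  (forall t r r', I t -> `|f t r - f t r'| <= K * `|r - r'|) ->
  (forall t, I t -> `|f t 0| <= c) ->
  exists u : R -> R, [/\ u 0 = 0,
    forall t, I t -> has_deriv I u t (f t (u t)) &
    forall t, I t -> `|u t| <= 2 * c * expR (2 * K * T)].
Proof.
move=> K1 c0 cf lip fc.
have cfu (u : R -> R) : continuous (fun t => u (cl t)) ->
    continuous (fun t => f (cl t) (u (cl t))).
  move=> cu t; apply: (continuous_at_comp (f := fun t => (cl t, u (cl t)))
    (g := fun p : R * R => f p.1 p.2)); last exact: cf.
  by apply: continuous_at_pair; [exact: clamp_continuous|exact: cu].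
have nxt (u : R -> R) : continuous (fun t => u (cl t)) ->
    exists w : R -> R, w 0 = 0 /\ forall t, I t -> has_deriv I w t (f t (u t)).
  move=> cu; have [F [F0 dF]] := primitive T (cfu u cu).
  by exists F; split => // t It; have := dF t It; rewrite (clamp_id It).
(* A primitive is available only for continuous data; the identity is a default value for other
   functions, which the iterates never are. *)
pose step (u : R -> R) : R -> R :=
  if pselect (continuous (fun t => u (cl t))) is left h then sval (cid (nxt u h)) else u.
have stepP u : continuous (fun t => u (cl t)) ->
    step u 0 = 0 /\ forall t, I t -> has_deriv I (step u) t (f t (u t)).
  by rewrite /step; case: pselect => // h _; case: cid.
have stepC u : continuous (fun t => u (cl t)) -> continuous (fun t => step u (cl t)).
  move=> /stepP [_ du]; apply: clamped_continuous.
  exact: has_deriv_continuous du.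
pose v k := iter k step (fun=> 0).
have vC k : continuous (fun t => v k (cl t)).
  by elim: k => [|k ih] /=; [move=> t; exact: cvg_cst|exact: stepC].
have v0 k : v k 0 = 0 by case: k => [//|k]; have [] := stepP _ (vC k).
have vD k t : I t -> has_deriv I (v k.+1) t (f t (v k t)).
  by have [_] := stepP _ (vC k); apply.
pose E (t : R) := expR (2 * K * t).
have E0 t : 0 < E t by exact: expR_gt0.
have dE (a t : R) : has_deriv I (fun s => a * E s) t (a * (2 * K * E t)).
  by apply: has_derivZ; exact: has_deriv_expR.
have E1 t : I t -> 1 <= E t.
  rewrite /= in_itv/= => /andP[t0 _]; rewrite /E -[leLHS]expR0 ler_expR.
  by rewrite mulr_ge0// mulr_ge0//; lra.
have dv k t : I t -> `|v k.+1 t - v k t| <= c * E t * 2^-1 ^+ k.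
  elim: k t => [|k ih] t It; have [t0 tT] := seg_bounds It.
    rewrite expr0 mulr1.
    have := @has_deriv_le _ T (v 1%N) (fun s => f s 0) (fun s => c * E s)
      (fun s => c * (2 * K * E s)) 0 t.
    rewrite v0 subr0 => h.
    apply: le_trans (h _ _ _ _ _ _) _ => //.
    - by move=> s Is; exact: (vD 0%N).
    - move=> s Is; apply: le_trans (fc s Is) _; rewrite ler_peMr//.
      by have := E1 s Is => h1; nra.
    - by rewrite lerBlDr lerDl mulr_ge0// ltW.
  have := @has_deriv_le _ T (fun s => v k.+2 s - v k.+1 s)
    (fun s => f s (v k.+1 s) - f s (v k s)) (fun s => c * 2^-1 ^+ k.+1 * E s)
      (fun s => c * 2^-1 ^+ k.+1 * (2 * K * E s)) 0 t.
  rewrite !v0 !subr0 => h.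
  apply: le_trans (h _ _ _ _ _ _) _ => //.
  - by move=> s Is; apply: has_derivB; exact: vD.
  - move=> s Is; apply: le_trans (lip _ _ _ Is) _.
    apply: (@le_trans _ _ (K * (c * E s * 2^-1 ^+ k))).
      by rewrite ler_wpM2l ?ih//; lra.
    by rewrite exprS le_eqVlt; apply/orP; left; apply/eqP; field.
  have : 0 <= c * 2^-1 ^+ k.+1 by rewrite mulr_ge0// exprn_ge0// invr_ge0.
  by have := E0 0; nra.
pose M := c * E T.
have EM t : I t -> c * E t <= M.
  rewrite /= in_itv/= => /andP[t0 tT]; rewrite /M ler_wpM2l// ler_expR.
  by rewrite ler_wpM2l//; lra.
(* The limit is chosen pointwise; outside [0, T] any value will do. *)
have lims t : exists l, I t -> forall k, `|l - v k t| <= 2 * M * 2^-1 ^+ k.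
  have [It|nIt] := pselect (I t); last by exists 0.
  have [l lP] := @geometric_limit R (v^~ t) (c * E t) (fun k => dv k t It).
  exists l => _ k; apply: le_trans (lP k) _.
  by rewrite ler_wpM2r ?exprn_ge0 ?invr_ge0// ler_wpM2l// EM.
pose u t := sval (cid (lims t)).
have uv t k : I t -> `|u t - v k t| <= 2 * M * 2^-1 ^+ k.
  by rewrite /u; case: cid => l /= + It; move=> /(_ It).
(* A uniform limit of continuous functions, by splitting [e] into three thirds. *)
have uC : continuous (fun t => u (cl t)).
  move=> t; apply/cvgrPdist_lt => e e0.
  have [k hk] := geometric_small (2 * M) (divr_gt0 e0 (ltr0Sn R 2)).
  have /cvgrPdist_lt /(_ _ (divr_gt0 e0 (ltr0Sn R 2))) := vC k t.
  apply: filterS => s hs.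
  have h1 := uv (cl t) k (clamp_in T0 t).
  have h2 := uv (cl s) k (clamp_in T0 s).
  move: h1 h2 hs; rewrite !ler_norml !ltr_norml => /andP[? ?] /andP[? ?] /andP[? ?].
  by apply/andP; split; lra.
(* The solution is the image [w] of the limit under one more Picard step: [w] has the right
   derivative by construction, and [wu] shows that the limit is a fixed point. *)
have [w [w0 dw]] := nxt u uC.
have wu t : I t -> w t = u t.
  move=> It; have [t0 tT] := seg_bounds It.
  apply/eqP; rewrite -subr_eq0 -normr_le0; apply/ler_addgt0Pr => e e0.
  rewrite add0r.
  (* [T * K] comes from integrating the Lipschitz bound on [w - v k.+1] over [0, T], and 1 covers
     the distance from [u] to [v k.+1]. *)
  have [k hk] := geometric_small ((T * K + 1) * (2 * M)) e0.
  have wv : `|w t - v k.+1 t| <= K * (2 * M * 2^-1 ^+ k) * t.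
    have := @has_deriv_le _ T (fun s => w s - v k.+1 s)
      (fun s => f s (u s) - f s (v k s)) (fun s => K * (2 * M * 2^-1 ^+ k) * s)
        (fun s => K * (2 * M * 2^-1 ^+ k) * 1) 0 t.
    rewrite w0 v0 !subr0 mulr0 subr0; apply => //.
    - by move=> s Is; apply: has_derivB; [exact: dw|exact: vD].
    - by move=> s Is; apply: has_derivZ; exact: has_deriv_id.
    - move=> s Is; apply: le_trans (lip _ _ _ Is) _.
      by rewrite mulr1 ler_wpM2l ?uv//; lra.
  have uv' := uv t k.+1 It.
  have M0 : 0 <= 2 * M * 2^-1 ^+ k.
    by rewrite mulr_ge0 ?exprn_ge0 ?invr_ge0// mulr_ge0// /M mulr_ge0// ltW.
  apply: (@le_trans _ _ (`|w t - v k.+1 t| + `|u t - v k.+1 t|)).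
    rewrite (_ : w t - u t = (w t - v k.+1 t) - (u t - v k.+1 t)); last by ring.
    exact: ler_normB.
  apply: le_trans (lerD wv uv') _.
  apply: le_trans (ltW hk).
  rewrite exprS (_ : (T * K + 1) * (2 * M) * 2^-1 ^+ k
     = (T * K + 1) * (2 * M * 2^-1 ^+ k)); last by ring.
  rewrite (_ : 2 * M * (2^-1 * 2^-1 ^+ k) = 2^-1 * (2 * M * 2^-1 ^+ k)); last by ring.
  move: M0; set X := 2 * M * _ => X0.
  have : K * X * t <= K * X * T by rewrite ler_wpM2l// mulr_ge0//; lra.
  lra.
exists w; split => // t It.
  by apply: has_deriv_eq (dw t It) _; rewrite (wu t It).
rewrite wu//; have := uv t 0%N It; rewrite (_ : v 0%N t = 0)// subr0 expr0 mulr1.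
by rewrite /M mulrA.
Qed.

End Picard.

(** * First variation of a scalar ODE depending on a parameter *)

Section Clip.
Context {R : realType}.
Variables (d : R) (d0 : 0 <= d).

(** Truncating the unknown turns a right-hand side controlled only for [|r| <= d] into one with
    global bounds; a solution that stays within [-d, d] also solves the original equation. *)
Definition clip (r : R) : R := Num.max (- d) (Num.min r d).

Lemma clip_le r : `|clip r| <= d.
Proof.
rewrite /clip ler_norml le_max lexx/= ge_max ge_min lexx orbT andbT.
by rewrite (le_trans _ d0)// oppr_le0.
Qed.

Lemma clip_id r : `|r| <= d -> clip r = r.
Proof.
by rewrite ler_norml /clip => /andP[rd dr]; rewrite (min_l dr) (max_r rd).
Qed.

Lemma clip_lip r r' : `|clip r - clip r'| <= `|r - r'|.
Proof.
wlog rr : r r' / r' <= r.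
  move=> h; have [|/ltW] := leP r' r; first exact: h.
  by rewrite distrC (distrC r); exact: h.
rewrite (ger0_norm (x := r - r')) ?subr_ge0// ler_norml /clip.
have cl (s : R) : (s <= - d /\ Num.max (- d) (Num.min s d) = - d) \/
    (- d <= s <= d /\ Num.max (- d) (Num.min s d) = s) \/
    (d <= s /\ Num.max (- d) (Num.min s d) = d).
  have dd : - d <= d by rewrite (le_trans _ d0)// oppr_le0.
  have [sd|/ltW sd] := leP s d; last by right; right; rewrite (max_r dd).
  have [ds|/ltW ds] := leP (- d) s; first by right; left.
  by left.
have d0' := d0; case: (cl r) => [[? ->]|[[/andP[? ?] ->]|[? ->]]];
  case: (cl r') => [[? ->]|[[/andP[? ?] ->]|[? ->]]]; apply/andP; split; lra.
Qed.

Lemma clip_continuous : continuous clip.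
Proof.
move=> t; apply: (@continuous_max R R (fun=> - d) (fun s : R => Num.min s d)).
  exact: cvg_cst.
by apply: (@continuous_min R R id (fun=> d)); [exact: cvg_id|exact: cvg_cst].
Qed.

End Clip.

Section FirstVariation.
Context {R : realType}.
Variables (T : R) (T0 : 0 < T).
Local Notation I := (`[0, T]%classic : set R).

Lemma bounded_on_segment (f : R -> R) : {within I, continuous f} ->
  exists2 B, 0 <= B & forall t, I t -> `|f t| <= B.
Proof.
move=> cf; have [c _ hc] : exists2 c, c \in `[0, T]%R &
    forall t, t \in `[0, T]%R -> `|f t| <= `|f c|.
  apply: (@EVT_max R (fun t => `|f t|)); first exact: ltW.
  move=> t; apply: (@continuous_comp (subspace I) R R f (fun r => `|r|)).
    exact: cf.
  exact: norm_continuous.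
by exists `|f c| => // t; exact: hc.
Qed.

(* The difference [r] between a perturbed and the reference solution solves
   [r' = Psi eps t r] with [Psi 0 t 0 = 0]; the integrating factor [lam] turns
   [lam r - eps N] into a function whose derivative is [o(eps)]. *)
Lemma ode_first_variation (Psi : R -> R -> R -> R) (a b lam N : R -> R) :
  (forall eps, continuous (fun p : R * R => Psi eps p.1 p.2)) ->
  {within I, continuous a} -> {within I, continuous b} ->
  (forall e, 0 < e -> exists2 d, 0 < d & forall eps t r, I t ->
     `|eps| <= d -> `|r| <= d ->
     `|Psi eps t r - eps * a t - r * b t| <= e * (`|eps| + `|r|)) ->
  (exists2 d, 0 < d & forall eps t r r', I t ->
     `|eps| <= d -> `|r| <= d -> `|r'| <= d ->
     `|Psi eps t r - Psi eps t r' - (r - r') * b t| <= `|r - r'|) ->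
  (exists2 d, 0 < d & forall eps (r : R -> R), `|eps| <= d ->
     (forall t, I t -> `|r t| <= d) -> r 0 = 0 ->
     (forall t, I t -> has_deriv I r t (Psi eps t (r t))) -> 0 <= r T) ->
  (forall t, I t -> 0 < lam t) ->
  (forall t, I t -> has_deriv I lam t (- b t * lam t)) ->
  N 0 = 0 -> (forall t, I t -> has_deriv I N t (lam t * a t)) ->
  N T = 0.
Proof.
move=> cPsi ca cb diff [d2 d20 lip] [d3 d30 minim] lam0 dlam N0 dN.
have [A A0 aA] := bounded_on_segment ca.
have [B B0 bB] := bounded_on_segment cb.
have [Lam Lam0 lamL] := bounded_on_segment (has_deriv_continuous dlam).
(* [K] is a Lipschitz constant of the clipped [Psi]: [B] for the linear term, 1 for the error
   allowed by the second smallness hypothesis. [D * |eps|] is the Picard bound with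
   [c = (A + 1) * |eps|], which dominates [Psi eps t 0] by the first smallness hypothesis taken with
   [e = 1]. *)
pose K := B + 1; have K1 : 1 <= K by rewrite lerDr.
pose D := 2 * (A + 1) * expR (2 * K * T).
have D0 : 0 <= D by rewrite mulr_ge0 ?expR_ge0// mulr_ge0// addr_ge0.
have [d1 d10 diff1] := diff 1 ltr01.
pose d := Num.min d1 (Num.min d2 d3).
have d0 : 0 < d by rewrite !lt_min d10 d20.
have dd1 : d <= d1 by rewrite ge_min lexx.
have dd2 : d <= d2 by rewrite !ge_min lexx !orbT.
have dd3 : d <= d3 by rewrite !ge_min lexx !orbT.
have sol eps : `|eps| <= d -> D * `|eps| <= d -> exists r : R -> R, [/\ r 0 = 0,
    forall t, I t -> has_deriv I r t (Psi eps t (r t)) &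
    forall t, I t -> `|r t| <= D * `|eps|].
  move=> epsd Deps.
  have [|||t r r' It|t It|u [u0 du uD]] := @picard R T T0
      (fun t r => Psi eps t (clip d r)) K ((A + 1) * `|eps|).
  - exact: K1.
  - by rewrite mulr_ge0// addr_ge0.
  - move=> p; apply: (continuous_at_comp (f := fun p : R * R => (p.1, clip d p.2))
      (g := fun p => Psi eps p.1 p.2)); last exact: cPsi.
    apply: continuous_at_pair; first exact: cvg_fst.
    apply: (continuous_at_comp (f := snd) (g := clip d)); first exact: cvg_snd.
    exact: clip_continuous.
  - have := lip eps t (clip d r) (clip d r') It (le_trans epsd dd2)
      (le_trans (clip_le (ltW d0) r) dd2) (le_trans (clip_le (ltW d0) r') dd2).
    have hl := clip_lip (ltW d0) r r'.
    set x := Psi _ _ _; set y := Psi _ _ _; set w := clip d r - _ => h.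
    have : `|x - y| <= `|x - y - w * b t| + `|w * b t|.
      by rewrite -{1}(subrK (w * b t) (x - y)) ler_normD.
    move=> /le_trans; apply; rewrite normrM.
    have := bB t It => hb.
    have : `|w| * `|b t| <= `|r - r'| * B by rewrite ler_pM.
    have : 0 <= `|w| by [].
    rewrite /K; move: h hl; rewrite -/w; nra.
  - rewrite clip_id; last by rewrite normr0 ltW.
    have := diff1 eps t 0 It (le_trans epsd dd1).
    rewrite normr0 mul0r subr0 addr0 mul1r => /(_ (ltW d10)) h.
    have : `|Psi eps t 0| <= `|Psi eps t 0 - eps * a t| + `|eps * a t|.
      by rewrite -{1}(subrK (eps * a t) (Psi eps t 0)) ler_normD.
    move=> /le_trans; apply; rewrite normrM.
    have : `|eps| * `|a t| <= `|eps| * A by rewrite ler_wpM2l ?aA.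
    lra.
  have uD' t : I t -> `|u t| <= D * `|eps|.
    by move=> It; apply: le_trans (uD t It) _; rewrite /D; lra.
  exists u; split => // t It; apply: has_deriv_eq (du t It) _.
  by rewrite clip_id// (le_trans (uD' t It)).
(* Minimality gives only the sign of [r T], hence a one-sided estimate of [eps * N T]; it is later
   read for both signs of [eps]. *)
have key e : 0 < e -> exists2 d', 0 < d' & forall eps, `|eps| <= d' ->
    - (Lam * (e * (1 + D)) * T * `|eps|) <= eps * N T.
  move=> e0; have [d4 d40 diff4] := diff e e0.
  pose m := Num.min d d4; have m0 : 0 < m by rewrite lt_min d0.
  have D1 : 0 < 1 + D by lra.
  exists (m / (1 + D)); first by rewrite divr_gt0.
  move=> eps epsm.
  (* The divisor [1 + D] makes [|eps|] and the bound [D * |eps|] on the solution fit together below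
     [m]. *)
  have hm : `|eps| + D * `|eps| <= m.
    by rewrite -{1}(mul1r `|eps|) -mulrDl mulrC -ler_pdivlMr.
  have De : 0 <= D * `|eps| by rewrite mulr_ge0.
  have E0 : 0 <= `|eps| by [].
  have md : m <= d by rewrite ge_min lexx.
  have md4 : m <= d4 by rewrite ge_min lexx orbT.
  have e1 : `|eps| <= m by apply: le_trans hm; rewrite lerDl.
  have e2 : D * `|eps| <= m by apply: le_trans hm; rewrite lerDr.
  have [r [r0 dr rD]] := sol eps (le_trans e1 md) (le_trans e2 md).
  have rT : 0 <= r T.
    apply: (minim eps r _ _ r0 dr); first by rewrite (le_trans e1)// (le_trans md).
    by move=> t It; rewrite (le_trans (rD t It))// (le_trans e2)// (le_trans md).
  have := @has_deriv_le R T (fun t => lam t * r t - eps * N t)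
    (fun t => lam t * (Psi eps t (r t) - eps * a t - r t * b t))
    (fun t => Lam * (e * (1 + D) * `|eps|) * t)
    (fun t => Lam * (e * (1 + D) * `|eps|) * 1) 0 T.
  rewrite N0 r0 !mulr0 !subr0 => h.
  have : `|lam T * r T - eps * N T| <= Lam * (e * (1 + D) * `|eps|) * T.
    apply: h => //; last exact: ltW.
    - move=> t It; apply: has_deriv_eq.
        apply: has_derivB; last exact: has_derivZ (dN t It).
        by apply: has_derivM (dlam t It) (dr t It).
      by rewrite /=; ring.
    - by move=> t It; apply: has_derivZ; exact: has_deriv_id.
    - move=> t It; rewrite normrM mulr1 ler_pM// ?lamL//.
      have h4 := diff4 eps t (r t) It (le_trans e1 md4)
        (le_trans (rD t It) (le_trans e2 md4)).
      apply: le_trans h4 _; rewrite -mulrA ler_wpM2l ?(ltW e0)//.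
      by have := rD t It; lra.
  rewrite ler_norml => /andP[h1 h2].
  have : 0 <= lam T * r T by rewrite mulr_ge0// ltW// lam0//; exact: itvT.
  lra.
apply/eqP; rewrite -normr_le0; apply/ler_addgt0Pr => e e0; rewrite add0r.
pose C := Lam * (1 + D) * T + 1.
have L0 : 0 <= Lam * (1 + D) * T.
  by rewrite mulr_ge0 ?(ltW T0)// mulr_ge0// addr_ge0.
have C0 : 0 < C by rewrite ltr_wpDl.
have [d' d'0 hd'] := key (e / C) (divr_gt0 e0 C0).
(* The values [d'] and [- d'] of [eps] bound [N T] from below and from above. *)
have hp := hd' d'; rewrite gtr0_norm// in hp; have {}hp := hp (lexx _).
have hn := hd' (- d'); rewrite normrN gtr0_norm// in hn; have {}hn := hn (lexx _).
have hC : Lam * (e / C * (1 + D)) * T <= e.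
  rewrite (_ : _ * T = e * ((Lam * (1 + D) * T) / C)); last by ring.
  rewrite ler_piMr ?(ltW e0)// ler_pdivrMr// mul1r /C; lra.
rewrite ler_norml; apply/andP; split.
  by rewrite -(ler_pM2l d'0); nra.
by rewrite -(ler_pM2l d'0); nra.
Qed.

End FirstVariation.

(** * Strict differentiability from continuous partial derivatives *)

Section StrictDerivative.
Context {R : realType}.

(** The intermediate point is located by the intervals [|x - s| < d] that contain both [a] and [b].
    This is insensitive to the order of [a] and [b], and it is how the point is later kept inside a
    neighbourhood. *)
Lemma mvt_convex (f df : R -> R) (a b : R) : (forall s : R, is_derive s 1 f (df s)) ->
  exists2 c, (forall s d, `|a - s| < d -> `|b - s| < d -> `|c - s| < d) &
    f b - f a = df c * (b - a).
Proof.
move=> hf; have fc x y : {within `[x, y], continuous f}.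
  apply: continuous_subspaceT => s; apply/differentiable_continuous.
  by apply/derivable1_diffP; have [] := hf s.
have [ab|/ltW ba] := leP a b.
  have [c] := MVT_segment ab (fun s _ => hf s) (fc a b).
  rewrite in_itv/= => /andP[ac cb] E; exists c => // s d.
  by rewrite !ltr_norml => /andP[? ?] /andP[? ?]; apply/andP; split; lra.
have [c] := MVT_segment ba (fun s _ => hf s) (fc b a).
rewrite in_itv/= => /andP[ac cb] E; exists c.
  by move=> s d; rewrite !ltr_norml => /andP[? ?] /andP[? ?]; apply/andP; split; lra.
by rewrite -opprB E; ring.
Qed.

Lemma near_prod_ball (P : topologicalType) (V : normedModType R) (p0 : P) (v0 : V)
    (S : P -> V -> Prop) : (\forall q \near (p0, v0), S q.1 q.2) ->
  exists2 U, nbhs p0 U & exists2 d, 0 < d &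
    forall p v, U p -> `|v - v0| < d -> S p v.
Proof.
move=> [[U B] /= [p0U /nbhs_ballP[d /= d0 dB]] UB].
exists U => //; exists d => // p v Up vd; apply: (UB (p, v)); split => //=.
by apply: dB; rewrite -ball_normE /= distrC.
Qed.

(** The mean value theorem turns joint continuity of the derivative into an estimate between two
    moving points that is uniform in the parameter. *)
Lemma strict_derivative1 (P : topologicalType) (F : P -> R -> R) (p0 : P) (s0 e : R) :
  (forall p (s : R), derivable (F p) s 1) ->
  {for (p0, s0), continuous (fun q : P * R => derive1 (F q.1) q.2)} -> 0 < e ->
  exists2 U, nbhs p0 U & exists2 d, 0 < d & forall p s s', U p ->
    `|s - s0| < d -> `|s' - s0| < d ->
    `|F p s' - F p s - derive1 (F p0) s0 * (s' - s)| <= e * `|s' - s|.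
Proof.
move=> dF cF e0; move/cvgrPdist_le : cF => /(_ _ e0) /= cF.
have [U p0U [d d0 H]] := @near_prod_ball _ R p0 s0
  (fun p s => `|derive1 (F p0) s0 - derive1 (F p) s| <= e) cF.
exists U => //; exists d => // p s s' Up sd s'd.
have [c cP ->] := @mvt_convex (F p) (derive1 (F p)) s s'
  (fun s => DeriveDef (dF p s) (esym (derive1E _ _))).
by rewrite -mulrBl normrM ler_wpM2r// distrC H// cP.
Qed.

Context {n : nat}.
Notation E := 'rV[R]_n.+1.

Lemma coord_le_norm (v : E) i : `|v ord0 i| <= `|v|.
Proof.
rewrite [leRHS]/Num.Def.normr/= mx_normrE.
exact: (le_bigmax _ (fun ij : 'I_1 * 'I_n.+1 => `|v ij.1 ij.2|) (ord0, i)).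
Qed.

Lemma norm_lt_coord (v : E) d : 0 < d -> (forall i, `|v ord0 i| < d) -> `|v| < d.
Proof.
move=> d0 h; rewrite [ltLHS]/Num.Def.normr/= mx_normrE.
by apply/bigmax_ltP; split => //= -[i j] _ /=; rewrite ord1.
Qed.

Lemma norm_le_coord (v : E) d : 0 <= d -> (forall i, `|v ord0 i| <= d) -> `|v| <= d.
Proof.
move=> d0 h; rewrite [leLHS]/Num.Def.normr/= mx_normrE.
by apply/bigmax_leP; split => //= -[i j] _ /=; rewrite ord1.
Qed.

Lemma partial_is_derive (f : E -> R) (v : E) i s : derivable_coord f v ->
  forall u, v = u + s *: delta_mx ord0 i ->
  is_derive s 1 (fun r => f (u + r *: delta_mx ord0 i)) (grad f v ord0 i).
Proof.
move=> df u vu; rewrite mxE.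
have E0 : (fun h : R => h^-1 *: (((fun r => f (u + r *: delta_mx ord0 i)) \o shift s)
      (h *: (1 : R)) - f (u + s *: delta_mx ord0 i)))
    = (fun h : R => h^-1 *: ((f \o shift v) (h *: delta_mx ord0 i) - f v)).
  apply/funext => h /=; rewrite vu [h *: 1]mulr1 scalerDl addrCA addrA.
  by congr (_ *: (f _ - _)); rewrite addrC addrA (addrC u) addrA.
by split; [rewrite /derivable E0; exact: df|rewrite /derive E0].
Qed.

Lemma dotpE (u v : E) : dotp u v = \sum_i u ord0 i * v ord0 i.
Proof. by []. Qed.

(** The passage from [y] to [y'] changes one coordinate at a time, each change being a one-variable
    mean value estimate with error [e / n.+1]. In the sup norm every intermediate point stays in the
    ball around [y0] that contains [y] and [y']. *)
Lemma strict_derivative (P : topologicalType) (F : P -> E -> R) (p0 : P) (y0 : E) (e : R) :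
  (forall p y, derivable_coord (F p) y) ->
  {for (p0, y0), continuous (fun q : P * E => grad (F q.1) q.2)} -> 0 < e ->
  exists2 U, nbhs p0 U & exists2 d, 0 < d & forall p y y', U p ->
    `|y - y0| < d -> `|y' - y0| < d ->
    `|F p y' - F p y - dotp (grad (F p0) y0) (y' - y)| <= e * `|y' - y|.
Proof.
move=> dF cF e0.
have e1 : 0 < e / n.+1%:R by rewrite divr_gt0.
move/cvgrPdist_le : cF => /(_ _ e1) /= cF.
have [U p0U [d d0 H]] := @near_prod_ball _ _ p0 y0
  (fun p y => `|grad (F p0) y0 - grad (F p) y| <= e / n.+1%:R) cF.
exists U => //; exists d => // p y y' Up yd y'd.
pose hyb (k : nat) : E := \row_i if (i < k)%N then y' ord0 i else y ord0 i.
have hyb0 : hyb 0%N = y by apply/rowP => i; rewrite mxE.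
have hybn : hyb n.+1 = y' by apply/rowP => i; rewrite mxE ltn_ord.
rewrite -{1}hybn -{1}hyb0 -(telescope_sumr (fun k => F p (hyb k))) // big_mkord.
rewrite dotpE -sumrB; apply: le_trans (ler_norm_sum _ _ _) _.
rewrite (_ : e * `|y' - y| = \sum_(i < n.+1) (e / n.+1%:R * `|y' - y|)); last first.
  by rewrite sumr_const card_ord -mulr_natr; field; rewrite addrC natr1 pnatr_eq0.
apply: ler_sum => i _.
(* [hyb i] and [hyb i.+1] lie on the line through [u] in direction [i], at parameters [y ord0 i] and
   [y' ord0 i]. *)
pose u : E := \row_j if j == i then 0 else hyb i ord0 j.
have hi : hyb i = u + y ord0 i *: delta_mx ord0 i.
  apply/rowP => j; rewrite !mxE eqxx/= -val_eqE/=; case: ltngtP => ij;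
    rewrite ?mulr0 ?addr0 ?mulr1 ?add0r//.
  by congr (y _ _); apply: val_inj.
have hi1 : hyb i.+1 = u + y' ord0 i *: delta_mx ord0 i.
  apply/rowP => j; rewrite !mxE eqxx/= -val_eqE/= ltnS; case: ltngtP => ij;
    rewrite ?mulr0 ?addr0 ?mulr1 ?add0r//.
  by congr (y' _ _); apply: val_inj.
have [c cP] := @mvt_convex (fun r => F p (u + r *: delta_mx ord0 i))
  (fun s => grad (F p) (u + s *: delta_mx ord0 i) ord0 i) (y ord0 i) (y' ord0 i)
  (fun s => partial_is_derive (dF p _) erefl).
rewrite -hi -hi1 => ->.
have cd : `|u + c *: delta_mx ord0 i - y0| < d.
  apply: norm_lt_coord => // j; rewrite !mxE eqxx/=.
  have yj : `|y ord0 j - y0 ord0 j| < d.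
    by apply: le_lt_trans yd; have := coord_le_norm (y - y0) j; rewrite !mxE.
  have y'j : `|y' ord0 j - y0 ord0 j| < d.
    by apply: le_lt_trans y'd; have := coord_le_norm (y' - y0) j; rewrite !mxE.
  case: eqVneq => [ji|ji].
    by rewrite mulr1 add0r ji; move: yj y'j; rewrite ji; exact: cP.
  by rewrite mulr0 addr0; case: ifP.
have := H p _ Up cd => /(le_trans (coord_le_norm _ i)).
rewrite mxE [X in _ + X]mxE => hg.
have := coord_le_norm (y' - y) i; rewrite [in X in X -> _]mxE [X in _ + X]mxE => hy.
rewrite !mxE -mulrBl normrM ler_pM// distrC.
by move: hg; rewrite !mxE.
Qed.

End StrictDerivative.

Section StrictNear.
Context {R : realType} {n : nat}.
Notation E := 'rV[R]_n.+1.

Lemma dotpB (u v w : E) : dotp u (v - w) = dotp u v - dotp u w.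
Proof. by rewrite /dotp -sumrB; apply: eq_bigr => i _; rewrite !mxE mulrBr. Qed.

Lemma dotpZ (u v : E) k : dotp u (k *: v) = k * dotp u v.
Proof. by rewrite /dotp mulr_sumr; apply: eq_bigr => i _; rewrite mxE; ring. Qed.

Lemma dotp_bound (u v : E) : `|dotp u v| <= (\sum_i `|u ord0 i|) * `|v|.
Proof.
rewrite mulr_suml; apply: le_trans (ler_norm_sum _ _ _) _.
by apply: ler_sum => i _; rewrite normrM ler_wpM2l// coord_le_norm.
Qed.

Lemma near_dist (X : topologicalType) (V : normedModType R) (f : X -> V) q0 d :
  {for q0, continuous f} -> 0 < d -> \forall q \near q0, `|f q - f q0| < d.
Proof.
move=> /cvgrPdist_lt /[apply]; apply: filterS => q.
by rewrite distrC.
Qed.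

Lemma strict_near1 (P X : topologicalType) (F : P -> R -> R) (p : X -> P)
    (s s' : X -> R) (q0 : X) (e : R) :
  (forall p (s : R), derivable (F p) s 1) ->
  {for (p q0, s q0), continuous (fun q : P * R => derive1 (F q.1) q.2)} -> 0 < e ->
  {for q0, continuous p} -> {for q0, continuous s} -> {for q0, continuous s'} ->
  s' q0 = s q0 ->
  \forall q \near q0, `|F (p q) (s' q) - F (p q) (s q)
      - derive1 (F (p q0)) (s q0) * (s' q - s q)| <= e * `|s' q - s q|.
Proof.
move=> dF cF e0 cp cs cs' ss.
have [U pU [d d0 H]] := strict_derivative1 dF cF e0.
have h1 : \forall q \near q0, U (p q) by exact: cp _ pU.
have h2 := near_dist cs d0; have h3 := near_dist cs' d0.
rewrite ss in h3.
by apply: filterS3 h1 h2 h3 => q; exact: H.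
Qed.

(** The form used for variations: base point, parameter and direction all move with [q], whereas the
    linear term is frozen at [q0]. *)
Lemma strict_near (P X : topologicalType) (F : P -> E -> R) (p : X -> P)
    (y Q : X -> E) (eps : X -> R) (q0 : X) (e : R) :
  (forall p y, derivable_coord (F p) y) ->
  {for (p q0, y q0), continuous (fun q : P * E => grad (F q.1) q.2)} -> 0 < e ->
  {for q0, continuous p} -> {for q0, continuous y} -> {for q0, continuous Q} ->
  {for q0, continuous eps} -> eps q0 = 0 ->
  \forall q \near q0, `|F (p q) (y q + eps q *: Q q) - F (p q) (y q)
      - eps q * dotp (grad (F (p q0)) (y q0)) (Q q0)| <= e * `|eps q|.
Proof.
move=> dF cF e0 cp cy cQ ce eps0.
(* Half of [e] pays for the strict derivative, [M] bounding the direction near [q0]; the other half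
   pays for replacing [Q q] by [Q q0], [G] being the norm of [dotp g] with respect to the sup
   norm. *)
set g := grad _ _; pose G := \sum_i `|g ord0 i|.
have G0 : 0 <= G by apply: sumr_ge0.
pose M := `|Q q0| + 1; have M0 : 0 < M by rewrite ltr_wpDl.
have e1 : 0 < e / 2 / M by rewrite !divr_gt0.
have [U pU [d d0 H]] := strict_derivative dF cF e1.
have cyQ : {for q0, continuous (fun q => y q + eps q *: Q q)}.
  by apply: cvgD => //; exact: cvgZ.
have h1 : \forall q \near q0, U (p q) by exact: cp _ pU.
have h2 := near_dist cy d0; have h3 := near_dist cyQ d0.
rewrite eps0 scale0r addr0 in h3.
have h4 := near_dist cQ ltr01.
have G1 : 0 < e / 2 / (G + 1) by rewrite !divr_gt0// ltr_wpDl.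
have h5 := near_dist cQ G1.
near=> q.
have q1 : U (p q) by near: q.
have q2 : `|y q - y q0| < d by near: q.
have q3 : `|y q + eps q *: Q q - y q0| < d by near: q.
have q4 : `|Q q - Q q0| < 1 by near: q.
have q5 : `|Q q - Q q0| < e / 2 / (G + 1) by near: q.
have := H _ _ _ q1 q2 q3.
rewrite (_ : y q + eps q *: Q q - y q = eps q *: Q q); last by rewrite addrC addKr.
rewrite dotpZ normrZ => h.
have QM : `|Q q| <= M.
  by rewrite -(subrK (Q q0) (Q q)) (le_trans (ler_normD _ _))// addrC lerD2l ltW.
have gQ : `|dotp g (Q q) - dotp g (Q q0)| <= e / 2.
  rewrite -dotpB; apply: le_trans (dotp_bound _ _) _; rewrite -/G.
  apply: (@le_trans _ _ ((G + 1) * (e / 2 / (G + 1)))).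
    by rewrite ler_pM ?lerDl// ltW.
  by rewrite mulrC divfK// gt_eqF// ltr_wpDl.
set A := F (p q) (y q + _) in h *; set B := F (p q) (y q) in h *.
set k := eps q in h *.
have -> : A - B - k * dotp g (Q q0) = (A - B - k * dotp g (Q q)) +
  k * (dotp g (Q q) - dotp g (Q q0)) by ring.
apply: le_trans (ler_normD _ _) _; rewrite (splitr e) mulrDl lerD//.
  apply: le_trans h _; rewrite mulrCA mulrC ler_wpM2r//.
  apply: (@le_trans _ _ (e / 2 / M * M)); last by rewrite divfK// gt_eqF.
  by rewrite ler_wpM2l// ltW.
by rewrite normrM mulrC ler_wpM2r.
Unshelve. all: by end_near. Qed.

(** Compactness of [0, T] gives one radius for all times. It is halved because the conclusion admits
    [|y| = d] while balls are open. *)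
Lemma near_segment (T : R) (Y : normedModType R) (S : R -> Y -> Prop) :
  (forall t0, `[0, T]%classic t0 -> \forall q \near (t0, 0 : Y), S q.1 q.2) ->
  exists2 d, 0 < d & forall t y, `[0, T]%classic t -> `|y| <= d -> S t y.
Proof.
move=> hS.
have cpt := @segment_compact R 0 T.
have /near_covering_withinP cov := (compact_near_coveringP _).1 cpt.
have H : \forall y \near (0 : Y), `[0, T]%classic `<=` (fun t => S t y).
  apply: (cov Y (nbhs (0 : Y)) (fun y t => S t y)) => t0 It0.
  by apply: filterS (hS t0 It0) => q Sq _.
have [d /= d0 dS] := (nbhs_ballP _ _).1 H; exists (d / 2); first by rewrite divr_gt0.
move=> t y It yd; apply: dS It => /=.
rewrite -ball_normE /= sub0r normrN; apply: le_lt_trans yd _; lra.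
Qed.

End StrictNear.

(** * First variation of the Herglotz ODE along a family of curves *)

Section LagrangianVariation.
Context {R : realType} {n : nat}.
Notation E := 'rV[R]_n.+1.
Variables (T : R) (T0 : 0 < T) (L : lagrangian R n) (LC1 : C1_lagrangian T L).
Local Notation I := (`[0, T]%classic : set R).
Local Notation cl := (clamp T).

(** [L] and its partial derivatives are controlled only for times in [0, T]; clamping the time gives
    composites that are continuous without restriction, as neighbourhoods in products require. *)
Lemma slab_continuous (V : topologicalType) (F : R -> E -> E -> E -> R -> V)
    (X : topologicalType) (t : X -> R) (x v w : X -> E) (z : X -> R) q :
  {within slab T, continuous (uncurry5 F)} ->
  {for q, continuous t} -> {for q, continuous x} -> {for q, continuous v} ->
  {for q, continuous w} -> {for q, continuous z} ->
  {for q, continuous (fun q => F (cl (t q)) (x q) (v q) (w q) (z q))}.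
Proof.
move=> cF ct cx cv cw cz.
apply: (within_continuous_comp (g := fun q => (cl (t q), x q, v q, w q, z q)) cF).
  by move=> q'; exact: clamp_in.
do 4 (apply: continuous_at_pair; last by []).
by apply: (continuous_at_comp (g := cl)) => //; exact: clamp_continuous.
Qed.

Ltac cproj := solve [ repeat first [exact: cvg_fst | exact: cvg_snd |
  apply: (continuous_at_comp (g := fst)) | apply: (continuous_at_comp (g := snd)) |
  exact: cvg_id] ].

Section Projections.
Context {A B C D F : topologicalType}.
Implicit Type q : A * B * C * D * F.

Lemma proj5_1_continuous q : {for q, continuous (fun q : A * B * C * D * F => q.1.1.1.1)}.
Proof. cproj. Qed.

Lemma proj5_2_continuous q : {for q, continuous (fun q : A * B * C * D * F => q.1.1.1.2)}.
Proof. cproj. Qed.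

Lemma proj5_3_continuous q : {for q, continuous (fun q : A * B * C * D * F => q.1.1.2)}.
Proof. cproj. Qed.

Lemma proj5_4_continuous q : {for q, continuous (fun q : A * B * C * D * F => q.1.2)}.
Proof. cproj. Qed.

Lemma proj5_5_continuous q : {for q, continuous (fun q : A * B * C * D * F => q.2)}.
Proof. cproj. Qed.

Lemma pair4_continuous (X : topologicalType) (fA : X -> A) (fB : X -> B)
    (fC : X -> C) (fD : X -> D) p : {for p, continuous fA} ->
  {for p, continuous fB} -> {for p, continuous fC} -> {for p, continuous fD} ->
  {for p, continuous (fun p => (fA p, fB p, fC p, fD p))}.
Proof. by move=> *; do !apply: continuous_at_pair. Qed.

End Projections.

(** Position, velocity and covariant acceleration of the varied curve at (eps, t). The increments
    are exactly [e *: Q] with [Q] still depending on [e], so that [Q (0, t)] is the derivative in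
    [e] at 0. *)
Variables (Y V W Q0 Q1 Q2 : R * R -> E) (Z : R -> R).
Hypotheses (cY : continuous Y) (cV : continuous V) (cW : continuous W)
  (cQ0 : continuous Q0) (cQ1 : continuous Q1) (cQ2 : continuous Q2)
  (cZ : continuous Z).
Hypotheses (YE : forall e t, Y (e, t) = Y (0, t) + e *: Q0 (e, t))
  (VE : forall e t, V (e, t) = V (0, t) + e *: Q1 (e, t))
  (WE : forall e t, W (e, t) = W (0, t) + e *: Q2 (e, t)).

Let at0 (U : Type) (F : R -> E -> E -> E -> R -> U) t :=
  F (cl t) (Y (0, t)) (V (0, t)) (W (0, t)) (Z t).

Let a t := dotp (at0 (L_x L) t) (Q0 (0, t)) + dotp (at0 (L_v L) t) (Q1 (0, t))
  + dotp (at0 (L_w L) t) (Q2 (0, t)).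
Let b t := at0 (L_z L) t.
Let Phi (t e r : R) := L (cl t) (Y (e, t)) (V (e, t)) (W (e, t)) (Z t + r).

Let at0_continuous (U : topologicalType) (F : R -> E -> E -> E -> R -> U) :
  {within slab T, continuous (uncurry5 F)} -> continuous (at0 F).
Proof.
move=> cF t; apply: slab_continuous.
- exact: cF.
- exact: cvg_id.
- by apply: (continuous_at_comp (g := Y));
    [apply: continuous_at_pair; [exact: cvg_cst|exact: cvg_id]|exact: cY].
- by apply: (continuous_at_comp (g := V));
    [apply: continuous_at_pair; [exact: cvg_cst|exact: cvg_id]|exact: cV].
- by apply: (continuous_at_comp (g := W));
    [apply: continuous_at_pair; [exact: cvg_cst|exact: cvg_id]|exact: cW].
- exact: cZ.
Qed.

Lemma dotp_continuous (X : topologicalType) (u v : X -> E) q : {for q, continuous u} ->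
  {for q, continuous v} -> {for q, continuous (fun q => dotp (u q) (v q))}.
Proof.
move=> cu cv; rewrite /prop_for /continuous_at /dotp.
apply: cvg_big => [|i _]; first exact: add_continuous.
apply: cvgM.
  by apply: (continuous_at_comp (g := fun M : E => M ord0 i)) => //; exact: coord_continuous.
by apply: (continuous_at_comp (g := fun M : E => M ord0 i)) => //; exact: coord_continuous.
Qed.

Let a_continuous : continuous a.
Proof.
move=> t; apply: cvgD; first apply: cvgD; apply: dotp_continuous.
- by apply: at0_continuous; exact: C1_cont_x LC1.
- by apply: (continuous_at_comp (g := Q0));
    [apply: continuous_at_pair; [exact: cvg_cst|exact: cvg_id]|exact: cQ0].
- by apply: at0_continuous; exact: C1_cont_v LC1.
- by apply: (continuous_at_comp (g := Q1));
    [apply: continuous_at_pair; [exact: cvg_cst|exact: cvg_id]|exact: cQ1].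
- by apply: at0_continuous; exact: C1_cont_w LC1.
- by apply: (continuous_at_comp (g := Q2));
    [apply: continuous_at_pair; [exact: cvg_cst|exact: cvg_id]|exact: cQ2].
Qed.

Let b_continuous : continuous b.
Proof. by apply: at0_continuous; exact: C1_cont_z LC1. Qed.

Let comp_cont (X : topologicalType) (U : R * R -> E) (e t : X -> R) q :
  continuous U -> {for q, continuous e} -> {for q, continuous t} ->
  {for q, continuous (fun q => U (e q, t q))}.
Proof.
move=> cU ce ct; apply: (continuous_at_comp (g := U)); last exact: cU.
exact: continuous_at_pair.
Qed.

Let grad_x_continuous (p : R * E * E * R) y : {for (p, y), continuous (fun q : R * E * E
    * R * E => grad (fun y => L (cl q.1.1.1.1) y q.1.1.1.2 q.1.1.2 q.1.2) q.2)}.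
Proof.
have h := @slab_continuous _ (L_x L) _ (fun q : R * E * E * R * E => q.1.1.1.1)
  (fun q => q.2) (fun q => q.1.1.1.2) (fun q => q.1.1.2) (fun q => q.1.2) (p, y) (C1_cont_x LC1).
have {}h := h (@proj5_1_continuous _ _ _ _ _ _).
have {}h := h (@proj5_5_continuous _ _ _ _ _ _).
have {}h := h (@proj5_2_continuous _ _ _ _ _ _).
have {}h := h (@proj5_3_continuous _ _ _ _ _ _).
have {}h := h (@proj5_4_continuous _ _ _ _ _ _).
exact: h.
Qed.

Let grad_v_continuous (p : R * E * E * R) y : {for (p, y), continuous (fun q : R * E * E
    * R * E => grad (fun y => L (cl q.1.1.1.1) q.1.1.1.2 y q.1.1.2 q.1.2) q.2)}.
Proof.
have h := @slab_continuous _ (L_v L) _ (fun q : R * E * E * R * E => q.1.1.1.1)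
  (fun q => q.1.1.1.2) (fun q => q.2) (fun q => q.1.1.2) (fun q => q.1.2) (p, y) (C1_cont_v LC1).
have {}h := h (@proj5_1_continuous _ _ _ _ _ _).
have {}h := h (@proj5_2_continuous _ _ _ _ _ _).
have {}h := h (@proj5_5_continuous _ _ _ _ _ _).
have {}h := h (@proj5_3_continuous _ _ _ _ _ _).
have {}h := h (@proj5_4_continuous _ _ _ _ _ _).
exact: h.
Qed.

Let grad_w_continuous (p : R * E * E * R) y : {for (p, y), continuous (fun q : R * E * E
    * R * E => grad (fun y => L (cl q.1.1.1.1) q.1.1.1.2 q.1.1.2 y q.1.2) q.2)}.
Proof.
have h := @slab_continuous _ (L_w L) _ (fun q : R * E * E * R * E => q.1.1.1.1)
  (fun q => q.1.1.1.2) (fun q => q.1.1.2) (fun q => q.2) (fun q => q.1.2) (p, y) (C1_cont_w LC1).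
have {}h := h (@proj5_1_continuous _ _ _ _ _ _).
have {}h := h (@proj5_2_continuous _ _ _ _ _ _).
have {}h := h (@proj5_3_continuous _ _ _ _ _ _).
have {}h := h (@proj5_5_continuous _ _ _ _ _ _).
have {}h := h (@proj5_4_continuous _ _ _ _ _ _).
exact: h.
Qed.

Let derive_z_continuous (p : R * E * E * E) (y : R) : {for (p, y), continuous (fun q : R
    * E * E * E * R => derive1 (fun y : R => L (cl q.1.1.1.1) q.1.1.1.2 q.1.1.2 q.1.2 y)
    q.2)}.
Proof.
have h := @slab_continuous _ (L_z L) _ (fun q : R * E * E * E * R => q.1.1.1.1)
  (fun q => q.1.1.1.2) (fun q => q.1.1.2) (fun q => q.1.2) (fun q => q.2) (p, y) (C1_cont_z LC1).
have {}h := h (@proj5_1_continuous _ _ _ _ _ _).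
have {}h := h (@proj5_2_continuous _ _ _ _ _ _).
have {}h := h (@proj5_3_continuous _ _ _ _ _ _).
have {}h := h (@proj5_4_continuous _ _ _ _ _ _).
have {}h := h (@proj5_5_continuous _ _ _ _ _ _).
exact: h.
Qed.

(** The position, the velocity, the acceleration and finally [z] are brought back to their reference
    values one at a time, the remaining arguments serving as parameters. The first three steps cost
    [e * |eps|] each, the last one [e * |r|]. *)
Let Phi_near t0 e : 0 < e ->
  \forall q \near (t0, (0, 0) : R * R),
    `|Phi q.1 q.2.1 q.2.2 - Phi q.1 0 0 - q.2.1 * a t0 - q.2.2 * b t0|
      <= 3 * e * `|q.2.1| + e * `|q.2.2|.
Proof.
move=> e0.
pose q0 : R * (R * R) := (t0, (0, 0)).
have c1 : {for q0, continuous (fun q : R * (R * R) => q.1)} by cproj.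
have c2 : {for q0, continuous (fun q : R * (R * R) => q.2.1)} by cproj.
have c3 : {for q0, continuous (fun q : R * (R * R) => q.2.2)} by cproj.
have cU (U : R * R -> E) : continuous U ->
    {for q0, continuous (fun q : R * (R * R) => U (q.2.1, q.1))}.
  by move=> cU; exact: comp_cont.
have cU0 (U : R * R -> E) : continuous U -> {for q0, continuous (fun q : R * (R * R) => U
    (0, q.1))}.
  by move=> cU'; apply: (comp_cont (e := fun=> 0)) => //; exact: cvg_cst.
have cz : {for q0, continuous (fun q : R * (R * R) => Z q.1)}.
  by apply: (continuous_at_comp (g := Z)) => //; exact: cZ.
have czr : {for q0, continuous (fun q : R * (R * R) => Z q.1 + q.2.2)}.
  exact: cvgD.
have h1 := @strict_near R n (R * E * E * R)%type (R * (R * R))%type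
  (fun p y => L (cl p.1.1.1) y p.1.1.2 p.1.2 p.2)
  (fun q => (q.1, V (q.2.1, q.1), W (q.2.1, q.1), Z q.1 + q.2.2))
  (fun q => Y (0, q.1)) (fun q => Q0 (q.2.1, q.1)) (fun q => q.2.1) q0 e.
have h2 := @strict_near R n (R * E * E * R)%type (R * (R * R))%type
  (fun p y => L (cl p.1.1.1) p.1.1.2 y p.1.2 p.2)
  (fun q => (q.1, Y (0, q.1), W (q.2.1, q.1), Z q.1 + q.2.2))
  (fun q => V (0, q.1)) (fun q => Q1 (q.2.1, q.1)) (fun q => q.2.1) q0 e.
have h3 := @strict_near R n (R * E * E * R)%type (R * (R * R))%type
  (fun p y => L (cl p.1.1.1) p.1.1.2 p.1.2 y p.2)
  (fun q => (q.1, Y (0, q.1), V (0, q.1), Z q.1 + q.2.2))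
  (fun q => W (0, q.1)) (fun q => Q2 (q.2.1, q.1)) (fun q => q.2.1) q0 e.
have h4 := @strict_near1 R (R * E * E * E)%type (R * (R * R))%type
  (fun p s => L (cl p.1.1.1) p.1.1.2 p.1.2 p.2 s)
  (fun q => (q.1, Y (0, q.1), V (0, q.1), W (0, q.1)))
  (fun q => Z q.1) (fun q => Z q.1 + q.2.2) q0 e.
have {}h1 := h1
  (fun p y => @C1_ex_x _ _ _ _ LC1 _ _ _ _ _ (clamp_in T0 _)).
have {}h2 := h2
  (fun p y => @C1_ex_v _ _ _ _ LC1 _ _ _ _ _ (clamp_in T0 _)).
have {}h3 := h3
  (fun p y => @C1_ex_w _ _ _ _ LC1 _ _ _ _ _ (clamp_in T0 _)).
have {}h4 := h4
  (fun p y => @C1_ex_z _ _ _ _ LC1 _ _ _ _ _ (clamp_in T0 _)).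

have {}h1 : \forall q \near q0,
    `|L (cl q.1) (Y (q.2.1, q.1)) (V (q.2.1, q.1)) (W (q.2.1, q.1)) (Z q.1 + q.2.2)
    - L (cl q.1) (Y (0, q.1)) (V (q.2.1, q.1)) (W (q.2.1, q.1)) (Z q.1 + q.2.2)
    - q.2.1 * dotp (at0 (L_x L) t0) (Q0 (0, t0))| <= e * `|q.2.1|.
  have {}h1 := h1 (@grad_x_continuous _ _)
    e0 (pair4_continuous c1 (cU _ cV) (cU _ cW) czr) (cU0 _ cY) (cU _ cQ0) c2 erefl.
  by apply: filterS h1 => q; rewrite /= -YE addr0.
have {}h2 : \forall q \near q0,
    `|L (cl q.1) (Y (0, q.1)) (V (q.2.1, q.1)) (W (q.2.1, q.1)) (Z q.1 + q.2.2)
    - L (cl q.1) (Y (0, q.1)) (V (0, q.1)) (W (q.2.1, q.1)) (Z q.1 + q.2.2)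
    - q.2.1 * dotp (at0 (L_v L) t0) (Q1 (0, t0))| <= e * `|q.2.1|.
  have {}h2 := h2 (@grad_v_continuous _ _)
    e0 (pair4_continuous c1 (cU0 _ cY) (cU _ cW) czr) (cU0 _ cV) (cU _ cQ1) c2 erefl.
  by apply: filterS h2 => q; rewrite /= -VE addr0.
have {}h3 : \forall q \near q0,
    `|L (cl q.1) (Y (0, q.1)) (V (0, q.1)) (W (q.2.1, q.1)) (Z q.1 + q.2.2)
    - L (cl q.1) (Y (0, q.1)) (V (0, q.1)) (W (0, q.1)) (Z q.1 + q.2.2)
    - q.2.1 * dotp (at0 (L_w L) t0) (Q2 (0, t0))| <= e * `|q.2.1|.
  have {}h3 := h3 (@grad_w_continuous _ _)
    e0 (pair4_continuous c1 (cU0 _ cY) (cU0 _ cV) czr) (cU0 _ cW) (cU _ cQ2) c2 erefl.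
  by apply: filterS h3 => q; rewrite /= -WE addr0.
have {}h4 : \forall q \near q0,
    `|L (cl q.1) (Y (0, q.1)) (V (0, q.1)) (W (0, q.1)) (Z q.1 + q.2.2)
    - L (cl q.1) (Y (0, q.1)) (V (0, q.1)) (W (0, q.1)) (Z q.1)
    - b t0 * q.2.2| <= e * `|q.2.2|.
  have {}h4 := h4 (@derive_z_continuous _ _)
    e0 (pair4_continuous c1 (cU0 _ cY) (cU0 _ cV) (cU0 _ cW)) cz czr (addr0 _).
  by apply: filterS h4 => q; rewrite /= (_ : Z q.1 + q.2.2 - Z q.1 = q.2.2); last by ring.
apply: filterS2 (filterI h1 h2) (filterI h3 h4) => q [] {}h1 {}h2 [] {}h3 {}h4.
move: h1 h2 h3 h4; rewrite /Phi /a addr0 !mulrDr (mulrC (b t0)).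
set P1 := L _ _ _ _ _; set P2 := L _ (Y (0, _)) _ _ _; set P3 := L _ _ (V (0, _)) _ _.
set P4 := L _ _ _ (W (0, _)) _; set P5 := L _ _ _ _ (Z q.1).
rewrite !ler_norml => /andP[? ?] /andP[? ?] /andP[? ?] /andP[? ?].
by apply/andP; split; lra.
Qed.

(** The constant 1/2 leaves another 1/2 for replacing [b t0] by [b t], so that the total is the
    constant 1 required by [ode_first_variation]. *)
Let Phi_lip_near t0 : 
  \forall q \near (t0, ((0, 0), 0) : R * R * R),
    `|Phi q.1 q.2.1.1 q.2.1.2 - Phi q.1 q.2.1.1 q.2.2 - (q.2.1.2 - q.2.2) * b t0|
      <= 2^-1 * `|q.2.1.2 - q.2.2|.
Proof.
pose q0 : R * (R * R * R) := (t0, ((0, 0), 0)).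
have c1 : {for q0, continuous (fun q : R * (R * R * R) => q.1)} by cproj.
have c2 : {for q0, continuous (fun q : R * (R * R * R) => q.2.1.1)} by cproj.
have c3 : {for q0, continuous (fun q : R * (R * R * R) => q.2.1.2)} by cproj.
have c4 : {for q0, continuous (fun q : R * (R * R * R) => q.2.2)} by cproj.
have cU (U : R * R -> E) : continuous U ->
    {for q0, continuous (fun q : R * (R * R * R) => U (q.2.1.1, q.1))}.
  by move=> cU; exact: comp_cont.
have cz : {for q0, continuous (fun q : R * (R * R * R) => Z q.1)}.
  by apply: (continuous_at_comp (g := Z)) => //; exact: cZ.
have czr : {for q0, continuous (fun q : R * (R * R * R) => Z q.1 + q.2.1.2)}.
  exact: cvgD.
have czr' : {for q0, continuous (fun q : R * (R * R * R) => Z q.1 + q.2.2)}.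
  exact: cvgD.
have h0 : 0 < 2^-1 :> R by rewrite invr_gt0.
have h := @strict_near1 R (R * E * E * E)%type (R * (R * R * R))%type
  (fun p s => L (cl p.1.1.1) p.1.1.2 p.1.2 p.2 s)
  (fun q => (q.1, Y (q.2.1.1, q.1), V (q.2.1.1, q.1), W (q.2.1.1, q.1)))
  (fun q => Z q.1 + q.2.2) (fun q => Z q.1 + q.2.1.2) q0 2^-1
  (fun p y => @C1_ex_z _ _ _ _ LC1 _ _ _ _ _ (clamp_in T0 _))
  (@derive_z_continuous _ _)
  h0 (pair4_continuous c1 (cU _ cY) (cU _ cV) (cU _ cW)) czr' czr erefl.
apply: filterS h => q; rewrite /= addr0 /Phi.
rewrite (_ : Z q.1 + q.2.1.2 - (Z q.1 + q.2.2) = q.2.1.2 - q.2.2); last by ring.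
by rewrite [X in _ - X](mulrC _ (q.2.1.2 - q.2.2)).
Qed.

(** The difference [r] between the perturbed and the reference [z] has right-hand side
    [Phi t e r - Phi t 0 0]; compactness makes the local estimates on [Phi] uniform in time, and the
    scalar result applies. *)
Lemma lagrangian_first_variation (lam N : R -> R) :
  (forall t, I t -> has_deriv I Z t (L t (Y (0, t)) (V (0, t)) (W (0, t)) (Z t))) ->
  (exists2 d, 0 < d & forall e s, `|e| <= d -> s 0 = Z 0 ->
     (forall t, I t -> has_deriv I s t (L t (Y (e, t)) (V (e, t)) (W (e, t)) (s t))) ->
     Z T <= s T) ->
  (forall t, I t -> 0 < lam t) ->
  (forall t, I t -> has_deriv I lam t
     (- L_z L t (Y (0, t)) (V (0, t)) (W (0, t)) (Z t) * lam t)) ->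
  N 0 = 0 ->
  (forall t, I t -> has_deriv I N t (lam t *
     (dotp (L_x L t (Y (0, t)) (V (0, t)) (W (0, t)) (Z t)) (Q0 (0, t))
      + dotp (L_v L t (Y (0, t)) (V (0, t)) (W (0, t)) (Z t)) (Q1 (0, t))
      + dotp (L_w L t (Y (0, t)) (V (0, t)) (W (0, t)) (Z t)) (Q2 (0, t))))) ->
  N T = 0.
Proof.
move=> dZ [dm dm0 minim] lam0 dlam N0 dN.
pose Psi e t r := Phi t e r - Phi t 0 0.
have Phi_cont e0 : continuous (fun p : R * R => Phi p.1 e0 p.2).
  move=> p; have c1 : {for p, continuous (fun p : R * R => p.1)} by cproj.
  have ce : {for p, continuous (fun p : R * R => e0)} by exact: cvg_cst.
  apply: slab_continuous; [exact: C1_cont LC1| | | | |] => //.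
  - exact: comp_cont.
  - exact: comp_cont.
  - exact: comp_cont.
  - apply: cvgD; last exact: cvg_snd.
    by apply: (continuous_at_comp (g := Z)) => //; exact: cZ.
have Phi0_cont : continuous (fun p : R * R => Phi p.1 0 0).
  move=> p.
  apply: (continuous_at_comp (f := fun p : R * R => (p.1, 0))
    (g := fun p : R * R => Phi p.1 0 p.2)); last exact: Phi_cont.
  by apply: continuous_at_pair; [cproj|exact: cvg_cst].
apply: (@ode_first_variation R T T0 Psi a b lam N) => //.
- move=> e p; apply: cvgB; [exact: Phi_cont|exact: Phi0_cont].
- exact: continuous_subspaceT.
- exact: continuous_subspaceT.
(* With [e / 4] the coefficient of [|eps|] is [3 * (e / 4)], plus [e / 4] for replacing [a t0] by
   [a t]; the coefficient of [|r|] is smaller. *)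
- move=> e e0; have e4 : 0 < e / 4 by rewrite divr_gt0.
  have near_t0 t0 : I t0 -> \forall q \near (t0, (0 : R * R)),
      `|Psi q.2.1 q.1 q.2.2 - q.2.1 * a q.1 - q.2.2 * b q.1|
        <= e * (`|q.2.1| + `|q.2.2|).
    move=> _; have ha : {for (t0, (0 : R * R)), continuous (fun q : R * (R * R) => a q.1)}.
      by apply: (continuous_at_comp (g := a)); [exact: cvg_fst|exact: a_continuous].
    have hb : {for (t0, (0 : R * R)), continuous (fun q : R * (R * R) => b q.1)}.
      by apply: (continuous_at_comp (g := b)); [exact: cvg_fst|exact: b_continuous].
    have {}ha := near_dist ha e4; have {}hb := near_dist hb e4.
    apply: filterS3 (Phi_near t0 e4) ha hb => q /= {}h ha hb.
    have h1 : `|q.2.1 * (a q.1 - a t0)| <= `|q.2.1| * (e / 4).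
      by rewrite normrM ler_wpM2l// ltW.
    have h2 : `|q.2.2 * (b q.1 - b t0)| <= `|q.2.2| * (e / 4).
      by rewrite normrM ler_wpM2l// ltW.
    have k1 : 0 <= `|q.2.1| * e by rewrite mulr_ge0// ltW.
    have k2 : 0 <= `|q.2.2| * e by rewrite mulr_ge0// ltW.
    move: h h1 h2; rewrite /Psi !ler_norml => /andP[? ?] /andP[? ?] /andP[? ?].
    by apply/andP; split; lra.
  have [d d0 dP] := @near_segment R T (R * R)%type
    (fun t y => `|Psi y.1 t y.2 - y.1 * a t - y.2 * b t| <= e * (`|y.1| + `|y.2|))
    near_t0.
  exists d => // k t r It kd rd; apply: (dP t (k, r)) => //.
  by rewrite /Num.norm /= ge_max kd.
- have near_t0 t0 : I t0 -> \forall q \near (t0, (0 : R * R * R)),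
      `|Psi q.2.1.1 q.1 q.2.1.2 - Psi q.2.1.1 q.1 q.2.2 - (q.2.1.2 - q.2.2) * b q.1|
        <= `|q.2.1.2 - q.2.2|.
    have h2 : 0 < 2^-1 :> R by rewrite invr_gt0.
    move=> _; have hb : {for (t0, (0 : R * R * R)),
        continuous (fun q : R * (R * R * R) => b q.1)}.
      by apply: (continuous_at_comp (g := b)); [exact: cvg_fst|exact: b_continuous].
    have {}hb := near_dist hb h2.
    apply: filterS2 (Phi_lip_near t0) hb => q /= h hb.
    have h1 : `|(q.2.1.2 - q.2.2) * (b q.1 - b t0)| <= `|q.2.1.2 - q.2.2| * 2^-1.
      by rewrite normrM ler_wpM2l// ltW.
    have -> : Psi q.2.1.1 q.1 q.2.1.2 - Psi q.2.1.1 q.1 q.2.2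
        - (q.2.1.2 - q.2.2) * b q.1
      = (Phi q.1 q.2.1.1 q.2.1.2 - Phi q.1 q.2.1.1 q.2.2 - (q.2.1.2 - q.2.2) * b t0)
        - (q.2.1.2 - q.2.2) * (b q.1 - b t0) by rewrite /Psi; ring.
    apply: le_trans (ler_normB _ _) _; apply: le_trans (lerD h h1) _; lra.
  have [d d0 dP] := @near_segment R T (R * R * R)%type
    (fun t y => `|Psi y.1.1 t y.1.2 - Psi y.1.1 t y.2 - (y.1.2 - y.2) * b t|
       <= `|y.1.2 - y.2|)
    near_t0.
  exists d => // k t r r' It kd rd rd'; apply: (dP t (k, r, r')) => //.
  by rewrite /Num.norm /= !ge_max kd rd.
- exists dm => // e r ed _ r0 dr.
  have := minim e (fun t => Z t + r t) ed.
  rewrite r0 addr0 => /(_ erefl); rewrite lerDl; apply => t It.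
  apply: has_deriv_eq (has_derivD (dZ t It) (dr t It)) _.
  by rewrite /Psi /Phi addr0 (clamp_id It) addrC subrK.
- by move=> t It; apply: has_deriv_eq (dlam t It) _; rewrite /b /at0 (clamp_id It).
- by move=> t It; apply: has_deriv_eq (dN t It) _; rewrite /a /at0 (clamp_id It).
Qed.

End LagrangianVariation.

(** * Coordinates and regularity of families of curves *)

Section Coordinates.
Context {R : realType} {n : nat}.
Notation E := 'rV[R]_n.+1.

Lemma has_deriv_coordP (A : set R) (f : R -> E) t (d : E) :
  has_deriv A f t d <-> forall i, has_deriv A (fun s => f s ord0 i) t (d ord0 i).
Proof.
split=> [h i|h].
  rewrite /has_deriv (_ : dquot _ t = fun s => dquot f t s ord0 i); last first.
    by apply/funext => s; rewrite /dquot !mxE.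
  apply: (cvg_comp (G := nbhs d) _ (fun M : E => M ord0 i)) h _.
  exact: coord_continuous.
apply/cvgrPdist_le => e e0.
have H : \forall s \near within A t^', forall i, `|d ord0 i - dquot f t s ord0 i| <= e.
  apply: filter_forall => i; have /cvgrPdist_le /(_ _ e0) := h i.
  by apply: filterS => s; rewrite /dquot !mxE.
apply: filterS H => s hs; apply: norm_le_coord; first exact: ltW.
by move=> i; have := hs i; rewrite !mxE.
Qed.

End Coordinates.

Section SmoothFamilies.
Context {R : realType}.
Variables (T : R) (T0 : 0 < T).
Local Notation I := (`[0, T]%classic : set R).
Local Notation cl := (clamp T).
Implicit Types h : R -> R -> R.

Definition jointly_continuous h := continuous (fun p : R * R => h p.1 (cl p.2)).

(* Families indexed by the first argument, of class C^m in the second one. *)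
Fixpoint smooth m h : Prop := jointly_continuous h /\
  if m is m'.+1 then (forall e t, I t -> derivable_along I (h e) t) /\
    smooth m' (fun e => derive_along I (h e)) else True.

Lemma smooth_jointly m h : smooth m h -> jointly_continuous h.
Proof. by case: m => [|m] []. Qed.

Lemma smooth0 h : jointly_continuous h -> smooth 0 h.
Proof. by []. Qed.

Lemma jointly_continuous_ext h h' : (forall e t, I t -> h e t = h' e t) ->
  jointly_continuous h -> jointly_continuous h'.
Proof.
move=> hh; rewrite /jointly_continuous.
rewrite (_ : (fun p : R * R => h' p.1 (cl p.2)) = (fun p : R * R => h p.1 (cl p.2)))//.
by apply/funext => p; rewrite hh//; exact: clamp_in.
Qed.

Lemma smooth_has_deriv m h e t : smooth m.+1 h -> I t ->
  has_deriv I (h e) t (derive_along I (h e) t).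
Proof. by case=> _ [d _] It; apply: derivable_has_deriv => //; exact: d. Qed.

Lemma smooth_derive m h : smooth m.+1 h -> smooth m (fun e => derive_along I (h e)).
Proof. by case=> _ []. Qed.

Lemma smooth_ext m h h' : (forall e t, I t -> h e t = h' e t) ->
  smooth m h -> smooth m h'.
Proof.
elim: m h h' => [|m ih] h h' hh; first by case=> jc _; split => //; exact:
    jointly_continuous_ext jc.
move=> sh; have jc := smooth_jointly sh.
have hd e t : I t -> has_deriv I (h' e) t (derive_along I (h e) t).
  move=> It; apply: (@has_deriv_ext _ _ I (h e)) => //; last exact: smooth_has_deriv sh It.
  by move=> s; rewrite inE => Is; exact: hh.
split; first exact: jointly_continuous_ext jc.
split; first by move=> e t It; apply: has_deriv_derivable (hd e t It).
apply: ih (smooth_derive sh) => e t It.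
by rewrite (has_deriv_derive T0 It (hd e t It)).
Qed.

(** Lets a derivative be exhibited as an explicit [dh], so that closure under each operation follows
    from the matching differentiation rule by induction on the order. *)
Lemma smoothS m h dh : jointly_continuous h ->
  (forall e t, I t -> has_deriv I (h e) t (dh e t)) -> smooth m dh -> smooth m.+1 h.
Proof.
move=> jc hd sd; split => //; split.
  by move=> e t It; apply: has_deriv_derivable (hd e t It).
by apply: smooth_ext sd => e t It; rewrite (has_deriv_derive T0 It (hd e t It)).
Qed.

Lemma smooth_weaken m h : smooth m.+1 h -> smooth m h.
Proof.
elim: m h => [|m ih] h [jc [d sd]]; first by split.
by split => //; split => //; exact: ih.
Qed.

Lemma smoothD m h h' : smooth m h -> smooth m h' -> smooth m (fun e t => h e t + h' e t).
Proof.
elim: m h h' => [|m ih] h h' sh sh'.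
  by split => // p; apply: cvgD; [exact: (smooth_jointly sh)|exact: (smooth_jointly sh')].
apply: smoothS (ih _ _ (smooth_derive sh) (smooth_derive sh')).
  by move=> p; apply: cvgD; [exact: (smooth_jointly sh)|exact: (smooth_jointly sh')].
by move=> e t It; apply: has_derivD; [exact: smooth_has_deriv sh It|
  exact: smooth_has_deriv sh' It].
Qed.

Lemma smoothM m h h' : smooth m h -> smooth m h' -> smooth m (fun e t => h e t * h' e t).
Proof.
elim: m h h' => [|m ih] h h' sh sh'.
  by split => // p; apply: cvgM; [exact: (smooth_jointly sh)|exact: (smooth_jointly sh')].
apply: smoothS (smoothD (ih _ _ (smooth_derive sh) (smooth_weaken sh'))
  (ih _ _ (smooth_weaken sh) (smooth_derive sh'))).
  by move=> p; apply: cvgM; [exact: (smooth_jointly sh)|exact: (smooth_jointly sh')].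
by move=> e t It; apply: has_derivM; [exact: smooth_has_deriv sh It|
  exact: smooth_has_deriv sh' It].
Qed.

Lemma smooth_const m (f : R -> R) : continuous f -> smooth m (fun e _ => f e).
Proof.
move=> cf; have jc g : continuous g -> jointly_continuous (fun e _ => g e).
  by move=> cg p; apply: (continuous_at_comp (g := g)); [exact: cvg_fst|exact: cg].
have s0 : forall k, smooth k (fun _ _ => 0).
  elim=> [|k ih]; first by split => //; apply: jc => x; exact: cvg_cst.
  apply: smoothS ih; first by apply: jc => x; exact: cvg_cst.
  by move=> e t It; exact: has_deriv_cst.
case: m => [|m]; first by split => //; exact: jc.
by apply: smoothS (s0 m); [exact: jc|move=> e t It; exact: has_deriv_cst].
Qed.

Lemma smooth_id m : smooth m (fun e _ => e).
Proof. by apply: smooth_const => x; exact: cvg_id. Qed.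

Lemma smooth_cst m (k : R) : smooth m (fun _ _ => k).
Proof. by apply: (@smooth_const m (fun=> k)) => x; exact: cvg_cst. Qed.

Lemma smoothV m h : (forall e t, h e t != 0) -> smooth m h ->
  smooth m (fun e t => (h e t)^-1).
Proof.
move=> h0; elim: m => [|m ih] sh.
  by split => // p; apply: cvgV; [exact: h0|exact: (smooth_jointly sh)].
have sV := ih (smooth_weaken sh).
apply: smoothS (smoothM (smooth_cst m (-1)) (smoothM (smooth_derive sh) (smoothM sV sV))).
  by move=> p; apply: cvgV; [exact: h0|exact: (smooth_jointly sh)].
move=> e t It; apply: has_deriv_eq (has_derivV It _ (smooth_has_deriv sh It)) _.
  by move=> s _; exact: h0.
by rewrite mulN1r expr2 invfM mulNr.
Qed.

Lemma smooth_slice m h e : smooth m h -> smooth m (fun _ => h e).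
Proof.
have jc g : jointly_continuous g -> jointly_continuous (fun _ => g e).
  move=> cg p; apply: (continuous_at_comp (f := fun p : R * R => (e, p.2))
    (g := fun p : R * R => g p.1 (cl p.2))); last exact: cg.
  by apply: continuous_at_pair; [exact: cvg_cst|exact: cvg_snd].
elim: m h => [|m ih] h sh; first by split => //; apply: jc; exact: smooth_jointly sh.
apply: smoothS (ih _ (smooth_derive sh)); first by apply: jc; exact: smooth_jointly sh.
by move=> _ t It; exact: smooth_has_deriv sh It.
Qed.

Lemma within_jointly_continuous (f : R -> R) : {within I, continuous f} ->
  jointly_continuous (fun _ => f).
Proof.
move=> cf p; apply: (continuous_at_comp (g := fun t => f (cl t))); first exact: cvg_snd.
exact: clamped_continuous.
Qed.

Lemma jointly_within_continuous (f : R -> R) : jointly_continuous (fun _ => f) ->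
  {within I, continuous f}.
Proof.
move=> cf; apply: (@subspace_eq_continuous _ _ _ (fun t => f (cl t))).
  by move=> t; rewrite inE => It; rewrite (clamp_id It).
apply: continuous_subspaceT => t.
apply: (continuous_at_comp (f := fun t : R => (t, t)) (g := fun p : R * R => f (cl p.2))).
  by apply: continuous_at_pair; exact: cvg_id.
exact: cf.
Qed.

Context {n : nat}.
Notation E := 'rV[R]_n.+1.

Lemma within_continuous_coordP (f : R -> E) : {within I, continuous f} <->
  forall i, {within I, continuous (fun t => f t ord0 i)}.
Proof.
split=> [cf i t|cf].
  by apply: (@continuous_comp (subspace I) E R f (fun M : E => M ord0 i));
    [exact: cf|exact: coord_continuous].
apply/subspace_continuousP => t It; apply/cvgrPdist_le => e e0.
have H : \forall s \near within I (nbhs t), forall i, `|f t ord0 i - f s ord0 i| <= e.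
  apply: filter_forall => i; have /subspace_continuousP /(_ t It) := cf i.
  by move/cvgrPdist_le => /(_ _ e0).
apply: filterS H => s hs; apply: norm_le_coord; first exact: ltW.
by move=> i; have := hs i; rewrite !mxE.
Qed.

Lemma has_deriv_coord_derive (f : R -> E) t i : I t -> derivable_along I f t ->
  has_deriv I (fun s => f s ord0 i) t (derive_along I f t ord0 i).
Proof. by move=> It /(derivable_has_deriv T0 It)/has_deriv_coordP. Qed.

Lemma Ck_smooth m (f : R -> E) i : Ck_along I m f -> smooth m (fun _ t => f t ord0 i).
Proof.
elim: m f => [|m ih] f [df cf].
  split => //; apply: within_jointly_continuous.
  by move: cf => /within_continuous_coordP.
have hd t : I t -> has_deriv I (fun s => f s ord0 i) t (derive_along I f t ord0 i).
  by move=> It; apply: has_deriv_coord_derive => //; exact: (df 0%N).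
apply: (smoothS (dh := fun _ t => derive_along I f t ord0 i)).
- by apply: within_jointly_continuous; exact: has_deriv_continuous hd.
- by move=> _; exact: hd.
apply: ih; split.
  by move=> j t jm It; have := df j.+1 t jm It; rewrite /deriven_along iterSr.
by move: cf; rewrite /deriven_along iterSr.
Qed.

Lemma smooth_Ck m (f : R -> E) : (forall i, smooth m (fun _ t => f t ord0 i)) ->
  Ck_along I m f.
Proof.
elim: m f => [|m ih] f sf.
  split => //; apply/within_continuous_coordP => i.
  by apply: jointly_within_continuous; exact: smooth_jointly (sf i).
have hd t : I t -> has_deriv I f t (\row_i derive_along I (fun s => f s ord0 i) t).
  move=> It; apply/has_deriv_coordP => i; rewrite mxE.
  exact: (smooth_has_deriv (sf i) It).
have [i|dC cC] := ih (derive_along I f).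
  apply: smooth_ext (smooth_derive (sf i)) => _ t It.
  by rewrite (has_deriv_derive T0 It (hd t It)) mxE.
split; last by rewrite /deriven_along iterSr.
case=> [|j] t jm It; first by apply: has_deriv_derivable (hd t It).
by rewrite /deriven_along iterSr; exact: dC.
Qed.

Lemma Ck_derive m (f : R -> E) : Ck_along I m.+1 f -> Ck_along I m (derive_along I f).
Proof.
move=> [df cf]; split; last by move: cf; rewrite /deriven_along iterSr.
by move=> j t jm It; have := df j.+1 t jm It; rewrite /deriven_along iterSr.
Qed.

Lemma Ck_clamp_continuous m (f : R -> E) : Ck_along I m f ->
  continuous (fun t => f (cl t)).
Proof.
move=> Cf t; apply: (within_continuous_comp (g := cl) (A := I)).
- apply/within_continuous_coordP => i; apply: jointly_within_continuous.
  exact: smooth_jointly (Ck_smooth i Cf).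
- by move=> s; exact: clamp_in.
exact: clamp_continuous.
Qed.

End SmoothFamilies.

#[global] Opaque smooth.

(** * Stationarity under variations that stay on the sphere *)

Section SphereVariation.
Context {R : realType} {n : nat}.
Notation E := 'rV[R]_n.+1.

Lemma dotpC (u v : E) : dotp u v = dotp v u.
Proof. by apply: eq_bigr => i _; rewrite mulrC. Qed.

Lemma dotpD (u v w : E) : dotp u (v + w) = dotp u v + dotp u w.
Proof. by rewrite /dotp -big_split; apply: eq_bigr => i _; rewrite mxE mulrDr. Qed.

Lemma dotpDl (u v w : E) : dotp (u + v) w = dotp u w + dotp v w.
Proof. by rewrite !(dotpC _ w) dotpD. Qed.

Lemma dotpZl (u v : E) k : dotp (k *: u) v = k * dotp u v.
Proof. by rewrite !(dotpC _ v) dotpZ. Qed.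

Lemma dotpBl (u v w : E) : dotp (u - v) w = dotp u w - dotp v w.
Proof. by rewrite !(dotpC _ w) dotpB. Qed.

Lemma row_continuous (X : topologicalType) (f : X -> 'I_n.+1 -> R) q :
  (forall l, {for q, continuous (fun p => f p l)}) ->
  {for q, continuous (fun p => \row_l f p l : E)}.
Proof.
move=> cf; apply/cvgrPdist_le => e e0.
have H : \forall p \near q, forall l, `|f q l - f p l| <= e.
  by apply: filter_forall => l; have /cvgrPdist_le /(_ _ e0) := cf l.
apply: filterS H => p hp; apply: norm_le_coord; first exact: ltW.
by move=> l; rewrite !mxE.
Qed.

Variables (T : R) (T0 : 0 < T).
Local Notation I := (`[0, T]%classic : set R).
Local Notation cl := (clamp T).
Local Notation D := (derive_along I).

Section Perturbation.
Variables (x : R -> E) (Q : 'I_n.+1 -> R -> R -> R).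
Hypotheses (sx : forall l, smooth T 4 (fun _ t => x t ord0 l))
  (sQ : forall l, smooth T 4 (Q l)).

Definition perturb e t : E := \row_l (x t ord0 l + e * Q l e t).
Definition Qrow (k : nat) e t : E := \row_l iter k D (Q l e) t.

Lemma smooth_perturb l : smooth T 4 (fun e t => perturb e t ord0 l).
Proof.
apply: (smooth_ext T0 (h := fun e t => x t ord0 l + e * Q l e t)).
  by move=> e t _; rewrite mxE.
by apply: smoothD => //; apply: smoothM => //; exact: smooth_id.
Qed.

Lemma perturb_Ck e : Ck_along I 4 (perturb e).
Proof.
apply: (smooth_Ck T0) => l.
have h := smooth_slice T0 e (smooth_perturb l).
exact: h.
Qed.

Lemma perturb_derive e t : I t -> D (perturb e) t = D x t + e *: Qrow 1 e t.
Proof.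
move=> It; apply: has_deriv_derive => //.
have Cx : Ck_along I 4 x by exact: smooth_Ck.
have dx : derivable_along I x t by exact: (Cx.1 0%N).
apply/has_deriv_coordP => l; rewrite !mxE /=.
apply: (@has_deriv_ext _ _ I (fun t => x t ord0 l + e * Q l e t)) => //.
  by move=> s _; rewrite mxE.
apply: has_derivD; first exact: has_deriv_coord_derive.
by apply: has_derivZ; exact: smooth_has_deriv (sQ l) It.
Qed.

Lemma perturb_derive2 e t : I t ->
  D (D (perturb e)) t = D (D x) t + e *: Qrow 2 e t.
Proof.
move=> It; apply: has_deriv_derive => //.
have Cx : Ck_along I 4 x by exact: smooth_Ck.
have dx : derivable_along I (D x) t by exact: (Cx.1 1%N).
apply/has_deriv_coordP => l; rewrite !mxE /=.
apply: (@has_deriv_ext _ _ I (fun t => D x t ord0 l + e * D (Q l e) t)) => //.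
  by move=> s; rewrite inE => Is; rewrite perturb_derive// !mxE.
apply: has_derivD; first exact: has_deriv_coord_derive.
by apply: has_derivZ; exact: smooth_has_deriv (smooth_derive (sQ l)) It.
Qed.

Lemma Qrow_continuous k : (k <= 4)%N -> continuous (fun p : R * R => Qrow k p.1 (cl p.2)).
Proof.
move=> k4 p; apply: row_continuous => l.
suff h m h' : smooth T (k + m) h' ->
    jointly_continuous T (fun e => iter k D (h' e)).
  by apply: (h (4 - k)%N (Q l) _ p); rewrite subnKC.
elim: k {k4} h' => [|k ih] h' sh'; first exact: smooth_jointly sh'.
have -> : (fun e => iter k.+1 D (h' e)) = (fun e => iter k D (D (h' e))).
  by apply/funext => e; rewrite iterSr.
by apply: ih; exact: smooth_derive sh'.
Qed.

End Perturbation.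

Variables (L : lagrangian R n) (z0 : R) (x0 xT v0 vT : E) (x : R -> E) (z : R -> R).
Hypotheses (LC1 : C1_lagrangian T L)
  (sol : herglotz_solution T L z0 x0 xT v0 vT x z).

Lemma solution_smooth l : smooth T 4 (fun _ t => x t ord0 l).
Proof. exact: (Ck_smooth T0 _ (adm_C4 sol.1)). Qed.

Lemma solution_has_deriv t : I t -> has_deriv I z t (along T L x z t).
Proof.
move=> It; have [_ _ Cz ode _ _ _ _ _] := sol.1.
by rewrite -ode//; apply: derivable_has_deriv => //; exact: (Cz.1 0%N).
Qed.

(** The vector paired with [L_w] is the derivative at [eps = 0] of the covariant acceleration, that
    is of [A - dotp A Y *: Y] with [Y] and [A] the varied position and acceleration. The four end
    conditions keep the boundary data fixed for every [eps]. *)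
Lemma variation_stationary (Q : 'I_n.+1 -> R -> R -> R) (lam N : R -> R) :
  (forall l, smooth T 4 (Q l)) ->
  (forall e t, I t -> dotp (perturb x Q e t) (perturb x Q e t) = 1) ->
  (forall e l, [/\ Q l e 0 = 0, Q l e T = 0, D (Q l e) 0 = 0 & D (Q l e) T = 0]) ->
  (forall t, I t -> 0 < lam t) ->
  (forall t, I t -> has_deriv I lam t (- along T (L_z L) x z t * lam t)) ->
  N 0 = 0 ->
  (forall t, I t -> has_deriv I N t (lam t *
    (dotp (along T (L_x L) x z t) (Qrow Q 0 0 t) +
     dotp (along T (L_v L) x z t) (Qrow Q 1 0 t) +
     dotp (along T (L_w L) x z t) (Qrow Q 2 0 t
       - (dotp (Qrow Q 2 0 t) (x t) + dotp (D (D x) t) (Qrow Q 0 0 t)) *: x t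
       - dotp (D (D x) t) (x t) *: Qrow Q 0 0 t)))) ->
  N T = 0.
Proof.
move=> sQ sph bd lam0 dlam N0 dN.
have [[C4 _ _ _ zz0 xx0 xxT vv0 vvT] minim] := sol.
pose X0 t := x (cl t); pose X1 t := D x (cl t); pose X2 t := D (D x) (cl t).
pose q k (p : R * R) := Qrow Q k p.1 (cl p.2).
pose Y (p : R * R) := X0 p.2 + p.1 *: q 0%N p.
pose V (p : R * R) := X1 p.2 + p.1 *: q 1%N p.
pose A (p : R * R) := X2 p.2 + p.1 *: q 2%N p.
pose W (p : R * R) := A p - dotp (A p) (Y p) *: Y p.
(* The exact quotient of the increment of [W] by [e]: writing [Y p] instead of the reference
   position in the middle term absorbs all higher powers of [e]. *)
pose qW (p : R * R) := q 2%N p - (dotp (q 2%N p) (Y p) + dotp (X2 p.2) (q 0%N p)) *: Y p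
  - dotp (X2 p.2) (X0 p.2) *: q 0%N p.
have cX0 : continuous X0 by exact: (@Ck_clamp_continuous R T T0 n 4 x C4).
have cX1 : continuous X1 by exact: (@Ck_clamp_continuous R T T0 n 3 _ (Ck_derive C4)).
have cX2 : continuous X2 by exact: (@Ck_clamp_continuous R T T0 n 2 _ (Ck_derive (Ck_derive C4))).
have cq k : (k <= 4)%N -> continuous (q k) by move=> k4; exact: Qrow_continuous.
have csnd (f : R -> E) : continuous f -> continuous (fun p : R * R => f p.2).
  by move=> cf p; apply: (continuous_at_comp (g := f)); [exact: cvg_snd|exact: cf].
have cfst : continuous (fun p : R * R => p.1) by move=> p; exact: cvg_fst.
have caff (f : R -> E) k : (k <= 4)%N -> continuous f ->
    continuous (fun p : R * R => f p.2 + p.1 *: q k p).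
  move=> k4 cf p; apply: cvgD; first exact: csnd.
  by apply: cvgZ; [exact: cfst|exact: cq].
have cY : continuous Y by exact: (caff X0 0%N isT cX0).
have cV : continuous V by exact: (caff X1 1%N isT cX1).
have cA : continuous A by exact: (caff X2 2%N isT cX2).
have cW : continuous W.
  move=> p; apply: cvgB; first exact: cA.
  by apply: cvgZ; [apply: dotp_continuous; [exact: cA|exact: cY]|exact: cY].
have cdot (f g : R * R -> E) : continuous f -> continuous g ->
    continuous (fun p => dotp (f p) (g p)).
  by move=> cf cg p; apply: dotp_continuous; [exact: cf|exact: cg].
have cqW : continuous qW.
  have c0 : continuous (q 0%N) := cq 0%N isT.
  have c2 : continuous (q 2%N) := cq 2%N isT.
  move=> p; apply: cvgB; first apply: cvgB; first exact: c2.
    apply: cvgZ; last exact: cY.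
    by apply: cvgD; [exact: (cdot _ _ c2 cY)|exact: (cdot _ _ (csnd _ cX2) c0)].
  by apply: cvgZ; [exact: (cdot _ _ (csnd _ cX2) (csnd _ cX0))|exact: c0].
have Y0 t : Y (0, t) = X0 t by rewrite /Y /= scale0r addr0.
have V0 t : V (0, t) = X1 t by rewrite /V /= scale0r addr0.
have A0 t : A (0, t) = X2 t by rewrite /A /= scale0r addr0.
have YE e t : Y (e, t) = Y (0, t) + e *: q 0%N (e, t) by rewrite Y0.
have VE e t : V (e, t) = V (0, t) + e *: q 1%N (e, t) by rewrite V0.
have WE e t : W (e, t) = W (0, t) + e *: qW (e, t).
  rewrite /W A0 Y0 /qW /A /=; set y := Y _; set b := q 2%N _; set a := q 0%N _.
  have -> : dotp (X2 t + e *: b) y *: y =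
    dotp (X2 t) (X0 t) *: X0 t + e *: ((dotp b y + dotp (X2 t) a) *: y
     + dotp (X2 t) (X0 t) *: a).
    have -> : dotp (X2 t + e *: b) y = dotp (X2 t) (X0 t) + e * (dotp b y + dotp (X2 t) a).
      by rewrite dotpDl dotpZl {1}/y /Y /= dotpD dotpZ -/a; ring.
    have hy l : y ord0 l = X0 t ord0 l + e * a ord0 l by rewrite /y /Y /= mxE mxE.
    move: (dotp _ _) (dotp b y + _) hy => d1 d2; move: y a (X0 t) => y a w hy.
    by apply/rowP => l; rewrite !mxE hy; ring.
  move: (q 2%N (e, t)) (dotp (X2 t) (X0 t)) (dotp _ y + _) => c d1 d2.
  by apply/rowP => l; rewrite !mxE; ring.
have W0 t : W (0, t) = X2 t - dotp (X2 t) (X0 t) *: X0 t by rewrite /W A0 Y0.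
pose Z t := z (cl t).
have cZ : continuous Z.
  by apply: clamped_continuous => //; exact: has_deriv_continuous solution_has_deriv.
have ZE : {in I, z =1 Z} by move=> s; rewrite inE => Is; rewrite /Z (clamp_id Is).
have along0 (U : Type) (F : R -> E -> E -> E -> R -> U) t : I t ->
    F t (Y (0, t)) (V (0, t)) (W (0, t)) (Z t) = along T F x z t.
  move=> It; rewrite Y0 V0 W0 /along /covacc /covD /X0 /X1 /X2 /Z.
  by rewrite (clamp_id It).
have yt e t : I t -> perturb x Q e t = Y (e, t).
  move=> It; rewrite /Y /q /X0 /= (clamp_id It).
  by apply/rowP => l; rewrite !mxE.
have vt e t : I t -> D (perturb x Q e) t = V (e, t).
  move=> It; rewrite /V /q /X1 /= (clamp_id It).
  exact: (perturb_derive solution_smooth sQ).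
have wt e t : I t -> covacc I (perturb x Q e) t = W (e, t).
  move=> It.
  have At : D (D x) t + e *: Qrow Q 2 e t = A (e, t).
    by rewrite /A /q /X2 /= (clamp_id It).
  rewrite /covacc /covD (perturb_derive2 solution_smooth sQ e It).
  by rewrite (yt e t It) At.
apply: (@lagrangian_first_variation R n T T0 L LC1 Y V W (q 0%N) (q 1%N) qW Z
  cY cV cW (cq 0%N isT) (cq 1%N isT) cqW cZ YE VE WE lam N) => //.
- move=> t It; rewrite along0//; apply: (has_deriv_ext It ZE).
  exact: solution_has_deriv.
(* The varied curve is admissible for every [e], so the radius is arbitrary. *)
- exists 1 => // e s _ sz ds.
  rewrite -(ZE T) ?inE; last exact: itvT.
  apply: (minim (perturb x Q e)); split.
  + exact: (perturb_Ck solution_smooth sQ).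
  + by move=> t It; rewrite /sphere /=; exact: sph.
  (* The perturbed [z] is of class C^1 because its derivative is [L] evaluated along continuous
     data. *)
  + split.
      by case=> // t _ It; exact: has_deriv_derivable (ds t It).
    have cs : continuous (fun t => s (cl t)).
      by apply: clamped_continuous => //; exact: has_deriv_continuous ds.
    have cg : continuous (fun t => L (cl t) (Y (e, t)) (V (e, t)) (W (e, t)) (s (cl t))).
      have cpair (U : R * R -> E) : continuous U -> continuous (fun t => U (e, t)).
        move=> cU t; apply: (continuous_at_comp (g := U)); last exact: cU.
        by apply: continuous_at_pair; [exact: cvg_cst|exact: cvg_id].
      move=> t; apply: (slab_continuous T0 (C1_cont LC1) (t := id)).
      - exact: cvg_id.
      - exact: (cpair _ cY).
      - exact: (cpair _ cV).
      - exact: (cpair _ cW).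
      - exact: cs.
    apply: (@subspace_eq_continuous _ _ _
      (fun t => L (cl t) (Y (e, t)) (V (e, t)) (W (e, t)) (s (cl t)))); last first.
      exact: continuous_subspaceT cg.
    move=> t; rewrite inE => It; rewrite (clamp_id It).
    symmetry; exact: (has_deriv_derive T0 It (ds t It)).
  + move=> t It; rewrite /along yt// vt// wt//; apply: has_deriv_derive => //.
    exact: ds.
  + by rewrite sz -(ZE 0) ?inE//; exact: itv0.
  + by rewrite -xx0; apply/rowP => l; rewrite mxE; have [-> _ _ _] := bd e l;
      rewrite mulr0 addr0.
  + by rewrite -xxT; apply/rowP => l; rewrite mxE; have [_ -> _ _] := bd e l;
      rewrite mulr0 addr0.
  + have I0 := itv0 T0; rewrite (perturb_derive solution_smooth sQ e I0).
    by rewrite -vv0; apply/rowP => l; rewrite !mxE /=; have [_ _ -> _] := bd e l;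
      rewrite mulr0 addr0.
  + have IT := itvT T0; rewrite (perturb_derive solution_smooth sQ e IT).
    by rewrite -vvT; apply/rowP => l; rewrite !mxE /=; have [_ _ _ ->] := bd e l;
      rewrite mulr0 addr0.
- by move=> t It; rewrite along0//; exact: dlam.
- move=> t It; rewrite !along0//; apply: has_deriv_eq (dN t It) _.
  by rewrite /qW /q Y0 /X2 /X0 /= (clamp_id It).
Qed.

End SphereVariation.

(** * Polynomial correction and the second-order du Bois-Reymond lemma *)

Section HermiteInterpolation.
Context {R : realType}.

Lemma derivn_XsubC_exp_mul (a : R) k (q : {poly R}) j : (j <= k)%N ->
  ((('X - a%:P) ^+ k * q)^`(j)).[a] = if j == k then k`!%:R * q.[a] else 0.
Proof.
elim: k q j => [|k ih] q j.
  by rewrite leqn0 => /eqP ->; rewrite derivn0 mul1r fact0 mul1r.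
case: j => [|j] jk; first by rewrite derivn0 hornerM horner_exp !hornerE subrr expr0n mul0r.
rewrite derivSn (_ : _^`() = ('X - a%:P) ^+ k * (k.+1%:R *: q + ('X - a%:P) * q^`())).
  rewrite ih// eqSS; case: eqVneq => // _.
  by rewrite !hornerE subrr mul0r addr0 mulrA factS natrM (mulrC k.+1%:R).
rewrite derivM deriv_exp derivXsubC mul1r [k.+1.-1]/= exprS mulrDr -scalerAr scaler_nat.
by rewrite mulrnAl mulrA (mulrC ('X - _)).
Qed.

(** Derivatives at [T] are prescribed one order at a time: adding [d *: ('X - T%:P) ^+ m] to [Q]
    leaves those of order below [m] unchanged and shifts the [m]-th one by [d * m! * T ^ 4]. The
    factor ['X^4] makes the derivatives of order below 4 vanish at 0. *)
Lemma hermite_interpolation (T : R) (c : nat -> R) m : 0 < T ->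
  exists2 Q : {poly R}, (size Q <= m)%N &
    forall j, (j < m)%N -> (('X^4 * Q)^`(j)).[T] = c j.
Proof.
move=> T0; elim: m => [|m [Q sQ hQ]]; first by exists 0; rewrite ?size_poly0.
pose d := (c m - (('X^4 * Q)^`(m)).[T]) / (m`!%:R * T ^+ 4).
exists (Q + d *: ('X - T%:P) ^+ m).
  apply: leq_trans (size_polyD _ _) _; rewrite geq_max (leq_trans sQ)//=.
  by apply: leq_trans (size_scale_leq _ _) _; rewrite size_exp_XsubC.
move=> j jm.
have -> : 'X^4 * (Q + d *: ('X - T%:P) ^+ m) = 'X^4 * Q + ('X - T%:P) ^+ m * (d *: 'X^4).
  by rewrite mulrDr -scalerAr (mulrC 'X^4 (_ ^+ _)) scalerAr.
rewrite derivnD hornerD derivn_XsubC_exp_mul; last by rewrite -ltnS.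
case: eqVneq => [->|jm']; last by rewrite addr0 hQ// ltn_neqAle jm' -ltnS.
rewrite hornerZ hornerXn mulrCA /d divfK ?subrKC//.
by rewrite mulf_neq0// ?pnatr_eq0 -?lt0n ?fact_gt0// expf_neq0// gt_eqF.
Qed.

End HermiteInterpolation.

Section DuBoisReymond.
Context {R : realType}.
Variables (T : R) (T0 : 0 < T).
Local Notation I := (`[0, T]%classic : set R).

Lemma primitive_within (f : R -> R) : {within I, continuous f} ->
  exists F : R -> R, F 0 = 0 /\ forall t, I t -> has_deriv I F t (f t).
Proof.
move=> cf; have [F [F0 dF]] := primitive T (clamped_continuous T0 cf).
by exists F; split => // t It; have := dF t It; rewrite (clamp_id It).
Qed.

Lemma has_deriv_horner (p : {poly R}) A t : has_deriv A (horner p) t (p^`()).[t].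
Proof. by apply: is_derive_has_deriv; exact: is_derive_poly. Qed.

Lemma within_continuousD (f g : R -> R) : {within I, continuous f} ->
  {within I, continuous g} -> {within I, continuous (fun t => f t + g t)}.
Proof. by move=> cf cg t; apply: cvgD; [exact: cf|exact: cg]. Qed.

Lemma within_continuousM (f g : R -> R) : {within I, continuous f} ->
  {within I, continuous g} -> {within I, continuous (fun t => f t * g t)}.
Proof. by move=> cf cg t; apply: cvgM; [exact: cf|exact: cg]. Qed.

Lemma within_continuousN (f : R -> R) : {within I, continuous f} ->
  {within I, continuous (fun t => - f t)}.
Proof. by move=> cf t; apply: cvgN; exact: cf. Qed.

(* With [G = A4 - B3 + C2] (indices count primitives), integration by parts turns
   the hypothesis into [int G phi'''' = 0]; testing against [phi'''' = G - p], with
   [p] the cubic making [phi] clamped at both ends, yields [G = p]. *)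
Lemma du_bois_reymond2 (A B C : R -> R) :
  {within I, continuous A} -> {within I, continuous B} -> {within I, continuous C} ->
  (forall phi phi1 phi2 phi3 phi4 N : R -> R,
    (forall t, I t -> [/\ has_deriv I phi t (phi1 t), has_deriv I phi1 t (phi2 t),
       has_deriv I phi2 t (phi3 t) & has_deriv I phi3 t (phi4 t)]) ->
    {within I, continuous phi4} ->
    [/\ phi 0 = 0, phi T = 0, phi1 0 = 0 & phi1 T = 0] ->
    N 0 = 0 ->
    (forall t, I t -> has_deriv I N t (A t * phi t + B t * phi1 t + C t * phi2 t)) ->
    N T = 0) ->
  exists A1 : R -> R, forall t, I t ->
    has_deriv I A1 t (A t) /\ has_deriv I C t (B t - A1 t).
Proof.
move=> cA cB cC H.
have prim f : {within I, continuous f} -> exists F : R -> R,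
    [/\ F 0 = 0, forall t, I t -> has_deriv I F t (f t) & {within I, continuous F}].
  move=> /primitive_within [F [F0 dF]]; exists F; split => //.
  exact: has_deriv_continuous dF.
have [A1 [A10 dA1 cA1]] := prim _ cA.
have [A2 [A20 dA2 cA2]] := prim _ cA1.
have [A3 [A30 dA3 cA3]] := prim _ cA2.
have [A4 [A40 dA4 cA4]] := prim _ cA3.
have [B1 [B10 dB1 cB1]] := prim _ cB.
have [B2 [B20 dB2 cB2]] := prim _ cB1.
have [B3 [B30 dB3 cB3]] := prim _ cB2.
have [C1 [C10 dC1 cC1]] := prim _ cC.
have [C2 [C20 dC2 cC2]] := prim _ cC1.
pose G t := A4 t - B3 t + C2 t.
have cG : {within I, continuous G}.
  by apply: within_continuousD => //; apply: within_continuousD => //; exact: within_continuousN.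
have [K1 [K10 dK1 cK1]] := prim _ cG.
have [K2 [K20 dK2 cK2]] := prim _ cK1.
have [K3 [K30 dK3 cK3]] := prim _ cK2.
have [K4 [K40 dK4 cK4]] := prim _ cK3.
(* The values at [T] of [K4] and of its first three derivatives, to be matched by [P] so that
   [K4 - P] is clamped there too. *)
pose c j := if j is 0%N then K4 T else if j is 1%N then K3 T else
  if j is 2%N then K2 T else K1 T.
have [Q sQ hQ] := hermite_interpolation c 4 T0.
pose P := 'X^4 * Q; pose p := P^`(4).
have P0 j : (j < 4)%N -> (P^`(j)).[0] = 0.
  by move=> j4; rewrite horner_coef0 coef_derivn addn0 coefXnM j4 mul0rn.
have PT j : (j < 4)%N -> (P^`(j)).[T] = c j by exact: hQ.
(* [P] has degree at most 7, one coefficient for each of the eight end conditions; its fourth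
   derivative [p] is a cubic. *)
have p4 : p^`(4) = 0.
  rewrite /p /derivn -iterD; apply: (@derivn_poly0 _ P 8).
  apply: leq_trans (size_polyMleq _ _) _; rewrite size_polyXn addSn /=.
  by rewrite (leq_add2l 4).
pose phi t := K4 t - P.[t]; pose phi1 t := K3 t - (P^`(1)).[t].
pose phi2 t := K2 t - (P^`(2)).[t]; pose phi3 t := K1 t - (P^`(3)).[t].
pose phi4 t := G t - p.[t].
have dP j t : has_deriv I (horner P^`(j)) t (P^`(j.+1)).[t].
  by rewrite derivnS; exact: has_deriv_horner.
have dphi t : I t -> [/\ has_deriv I phi t (phi1 t), has_deriv I phi1 t (phi2 t),
    has_deriv I phi2 t (phi3 t) & has_deriv I phi3 t (phi4 t)].
  move=> It; split; apply: has_derivB; [exact: dK4|exact: (dP 0%N)|exact: dK3|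
    exact: (dP 1%N)|exact: dK2|exact: (dP 2%N)|exact: dK1|exact: (dP 3%N)].
have cp : {within I, continuous (horner p)}.
  by apply: continuous_subspaceT; exact: continuous_horner.
have cphi4 : {within I, continuous phi4}.
  by apply: within_continuousD => //; exact: within_continuousN.
have phi_0 : [/\ phi 0 = 0, phi1 0 = 0, phi2 0 = 0 & phi3 0 = 0].
  rewrite /phi /phi1 /phi2 /phi3 K40 K30 K20 K10.
  by rewrite -[P]/(P^`(0)) !P0// !subr0.
have phi_T : [/\ phi T = 0, phi1 T = 0, phi2 T = 0 & phi3 T = 0].
  rewrite /phi /phi1 /phi2 /phi3.
  have e0 : P.[T] = K4 T := PT 0%N isT; have e1 : (P^`(1)).[T] = K3 T := PT 1%N isT.
  have e2 : (P^`(2)).[T] = K2 T := PT 2%N isT; have e3 : (P^`(3)).[T] = K1 T := PT 3%N isT.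
  by rewrite e0 e1 e2 e3 !subrr.
have [p00 p10 p20 p30] := phi_0; have [p0T p1T p2T p3T] := phi_T.
have cphi : {within I, continuous phi}.
  by apply: (has_deriv_continuous (df := phi1)) => t /dphi[].
have cphi1 : {within I, continuous phi1}.
  by apply: (has_deriv_continuous (df := phi2)) => t /dphi[].
have cphi2 : {within I, continuous phi2}.
  by apply: (has_deriv_continuous (df := phi3)) => t /dphi[].
have [N [N0 dN _]] := prim _ (within_continuousD (within_continuousD
  (within_continuousM cA cphi) (within_continuousM cB cphi1)) (within_continuousM cC cphi2)).
have NT : N T = 0 by apply: (H phi phi1 phi2 phi3 phi4 N dphi cphi4) => //; split.
have hphi4 t : phi4 t = A4 t - B3 t + C2 t - p.[t] by [].
clearbody phi phi1 phi2 phi3 phi4 => {dP P0 PT}; clearbody p => {P}.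
(* [N] minus the boundary terms of all the integrations by parts. What remains in its derivative is
   [(A4 - B3 + C2 - p) * phi4], the square of [phi4]. *)
pose D t := N t
  - (A1 t * phi t - A2 t * phi1 t + A3 t * phi2 t - A4 t * phi3 t
     + B1 t * phi1 t - B2 t * phi2 t + B3 t * phi3 t + C1 t * phi2 t - C2 t * phi3 t)
  - (p.[t] * phi3 t - (p^`(1)).[t] * phi2 t + (p^`(2)).[t] * phi1 t
     - (p^`(3)).[t] * phi t).
have dp j t : has_deriv I (horner p^`(j)) t (p^`(j.+1)).[t].
  by rewrite derivnS; exact: has_deriv_horner.
have dD t : I t -> has_deriv I D t (phi4 t ^+ 2).
  move=> It; have [d1 d2 d3 d4] := dphi t It.
  apply: has_deriv_eq.
    exact: (has_derivB (has_derivB (dN t It)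
      (has_derivB (has_derivD (has_derivD (has_derivB (has_derivD (has_derivB
        (has_derivD (has_derivB (has_derivM (dA1 t It) d1) (has_derivM (dA2 t It) d2))
          (has_derivM (dA3 t It) d3)) (has_derivM (dA4 t It) d4))
          (has_derivM (dB1 t It) d2)) (has_derivM (dB2 t It) d3))
          (has_derivM (dB3 t It) d4)) (has_derivM (dC1 t It) d3))
          (has_derivM (dC2 t It) d4)))
      (has_derivB (has_derivD (has_derivB (has_derivM (dp 0%N t) d4)
        (has_derivM (dp 1%N t) d3)) (has_derivM (dp 2%N t) d2)) (has_derivM (dp 3%N t) d1))).
  by rewrite p4 horner0 hphi4; ring.
have D0 : D 0 = 0 by rewrite /D N0 p00 p10 p20 p30; ring.
have DT : D T = 0 by rewrite /D NT p0T p1T p2T p3T; ring.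
(* A nondecreasing function that vanishes at both ends is zero, hence so is its derivative
   [phi4 ^+ 2]. *)
have Dz t : I t -> D t = 0.
  move=> It; have [t0 tT] := seg_bounds It; apply/eqP; rewrite eq_le.
  have mono := has_deriv_nondecr dD (fun t _ => sqr_ge0 (phi4 t)).
  by apply/andP; split; [rewrite -DT mono|rewrite -D0 mono].
have GE t : I t -> G t = p.[t].
  move=> It; have d0 : has_deriv I D t 0.
    apply: (has_deriv_ext It _ (has_deriv_cst I 0 t)) => s.
    by rewrite inE => Is; rewrite Dz.
  have /eqP := has_deriv_uniq T0 It (dD t It) d0.
  by rewrite sqrf_eq0 hphi4 subr_eq0 => /eqP.
(* Two differentiations of [G = p] lead back to [C], now expressed through differentiable
   functions. *)
have GE1 t : I t -> A3 t - B2 t + C1 t = (p^`(1)).[t].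
  move=> It; apply: (has_deriv_uniq T0 It (f := G)).
    by apply: has_derivD; [apply: has_derivB; [exact: dA4|exact: dB3]|exact: dC2].
  apply: (has_deriv_ext It _ (dp 0%N t)) => s.
  by rewrite inE => Is; rewrite GE.
have GE2 t : I t -> A2 t - B1 t + C t = (p^`(2)).[t].
  move=> It; apply: (has_deriv_uniq T0 It (f := fun t => A3 t - B2 t + C1 t)).
    by apply: has_derivD; [apply: has_derivB; [exact: dA3|exact: dB2]|exact: dC1].
  apply: (has_deriv_ext It _ (dp 1%N t)) => s.
  by rewrite inE => Is; rewrite GE1.
(* The third derivative of [p] is constant, so subtracting it from [A1] gives another primitive of
   [A]. *)
exists (fun t => A1 t - (p^`(3)).[t]) => t It; split.
  apply: has_deriv_eq (has_derivB (dA1 t It) (dp 3%N t)) _.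
  by rewrite p4 horner0 subr0.
apply: (@has_deriv_ext _ _ I (fun t => (p^`(2)).[t] - A2 t + B1 t)) => //.
  by move=> s; rewrite inE => Is; rewrite -GE2//; ring.
apply: has_deriv_eq.
  by apply: has_derivD; [apply: has_derivB; [exact: (dp 2%N)|exact: dA2]|exact: dB1].
by rewrite /=; ring.
Qed.

End DuBoisReymond.

(** * Rotations in coordinate planes *)

Section Rotations.
Context {R : realType} {n : nat}.
Notation E := 'rV[R]_n.+1.
Implicit Types (u v w : E) (i j : 'I_n.+1).

(** A coordinate of the bivector [u] wedge [v]. It vanishes on parallel vectors, so with [v = x] it
    does not see the normal component of [u]. *)
Definition bracket i j u v : R := u ord0 i * v ord0 j - u ord0 j * v ord0 i.

(* Infinitesimal generator of the rotations in the coordinate plane (i, j). *)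
Definition rot i j u : E :=
  u ord0 j *: delta_mx ord0 i - u ord0 i *: delta_mx ord0 j.

Definition plane_part i j u : E :=
  u ord0 i *: delta_mx ord0 i + u ord0 j *: delta_mx ord0 j.

Lemma dotp_delta u i : dotp u (delta_mx ord0 i) = u ord0 i.
Proof.
rewrite /dotp (bigD1 i)//= mxE !eqxx mulr1 big1 ?addr0// => j ji.
by rewrite mxE (negbTE ji) andbF mulr0.
Qed.

Lemma dotp_rot u i j v : dotp u (rot i j v) = bracket i j u v.
Proof. by rewrite /rot dotpB !dotpZ !dotp_delta /bracket; ring. Qed.

Lemma dotp_rotl u i j v : dotp (rot i j v) u = bracket i j u v.
Proof. by rewrite dotpC dotp_rot. Qed.

Lemma rot_coord i j u l : rot i j u ord0 l =
  (delta_mx ord0 i : E) ord0 l * u ord0 j - (delta_mx ord0 j : E) ord0 l * u ord0 i.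
Proof. by rewrite /rot !mxE; ring. Qed.

Lemma plane_part_coord i j u l : plane_part i j u ord0 l =
  (delta_mx ord0 i : E) ord0 l * u ord0 i + (delta_mx ord0 j : E) ord0 l * u ord0 j.
Proof. by rewrite /plane_part !mxE; ring. Qed.

Lemma dotp_rotation i j u a b : i != j -> 2 * a + a ^+ 2 + b ^+ 2 = 0 ->
  dotp (u + a *: plane_part i j u + b *: rot i j u)
       (u + a *: plane_part i j u + b *: rot i j u) = dotp u u.
Proof.
move=> ij ab; have ji : (j == i) = false by rewrite eq_sym (negbTE ij).
rewrite /plane_part /rot -scaleNr.
rewrite !(dotpD, dotpZ, dotpDl, dotpZl) !dotp_delta.
rewrite !(dotpC (delta_mx _ _) u) !dotp_delta !mxE !eqxx (negbTE ij) ji /=.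
set p := u ord0 i; set q := u ord0 j.
apply/eqP; rewrite -subr_eq0; apply/eqP.
transitivity ((2 * a + a ^+ 2 + b ^+ 2) * (p ^+ 2 + q ^+ 2)); last by rewrite ab mul0r.
ring.
Qed.

End Rotations.

(** * Differentiable functions on [0, T] *)

Section Differentiable.
Context {R : realType} {n : nat}.
Notation E := 'rV[R]_n.+1.
Variables (T : R) (T0 : 0 < T).
Local Notation I := (`[0, T]%classic : set R).
Local Notation D := (derive_along I).
Implicit Types (f g : R -> R) (u v : R -> E).

Definition differentiable_on (V : normedModType R) (f : R -> V) :=
  forall t, I t -> derivable_along I f t.

Lemma differentiable_has_deriv (V : normedModType R) (f : R -> V) t :
  differentiable_on f -> I t -> has_deriv I f t (D f t).
Proof. by move=> df It; apply: derivable_has_deriv => //; exact: df. Qed.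

Lemma differentiable_continuous_on f : differentiable_on f -> {within I, continuous f}.
Proof.
move=> df; apply: (has_deriv_continuous (df := D f)) => t It.
exact: differentiable_has_deriv.
Qed.

Lemma differentiable_onD f g : differentiable_on f -> differentiable_on g ->
  differentiable_on (fun t => f t + g t).
Proof.
move=> df dg t It; apply: has_deriv_derivable.
by apply: has_derivD; apply: differentiable_has_deriv.
Qed.

Lemma differentiable_onB f g : differentiable_on f -> differentiable_on g ->
  differentiable_on (fun t => f t - g t).
Proof.
move=> df dg t It; apply: has_deriv_derivable.
by apply: has_derivB; apply: differentiable_has_deriv.
Qed.

Lemma differentiable_onM f g : differentiable_on f -> differentiable_on g ->
  differentiable_on (fun t => f t * g t).
Proof.
move=> df dg t It; apply: has_deriv_derivable.
by apply: has_derivM; apply: differentiable_has_deriv.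
Qed.

Lemma differentiable_on_cst (k : R) : differentiable_on (fun=> k).
Proof. by move=> t It; apply: has_deriv_derivable (has_deriv_cst _ _ _). Qed.

Lemma has_deriv_dotp u v t du dv : has_deriv I u t du -> has_deriv I v t dv ->
  has_deriv I (fun s => dotp (u s) (v s)) t (dotp du (v t) + dotp (u t) dv).
Proof.
move=> /has_deriv_coordP hu /has_deriv_coordP hv.
rewrite /dotp -big_split /=; apply: has_deriv_sum => i.
exact: has_derivM.
Qed.

Lemma has_deriv_bracket i j u v t du dv : has_deriv I u t du -> has_deriv I v t dv ->
  has_deriv I (fun s => bracket i j (u s) (v s)) t
    (bracket i j du (v t) + bracket i j (u t) dv).
Proof.
move=> /has_deriv_coordP hu /has_deriv_coordP hv.
apply: has_deriv_eq (has_derivB (has_derivM (hu i) (hv j)) (has_derivM (hu j) (hv i))) _.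
by rewrite /bracket; ring.
Qed.

Lemma differentiable_dotp u v : differentiable_on u -> differentiable_on v ->
  differentiable_on (fun t => dotp (u t) (v t)).
Proof.
move=> du dv t It; apply: has_deriv_derivable.
by apply: has_deriv_dotp; apply: differentiable_has_deriv.
Qed.

Lemma differentiable_bracket i j u v : differentiable_on u -> differentiable_on v ->
  differentiable_on (fun t => bracket i j (u t) (v t)).
Proof.
move=> du dv t It; apply: has_deriv_derivable.
by apply: has_deriv_bracket; apply: differentiable_has_deriv.
Qed.

End Differentiable.

(** * The variation field of a rotation and its derivatives at eps = 0 *)

Section RotationVariation.
Context {R : realType} {n : nat}.
Notation E := 'rV[R]_n.+1.
Variables (T : R) (T0 : 0 < T).
Local Notation I := (`[0, T]%classic : set R).
Local Notation D := (derive_along I).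
Variables (x : R -> E) (i j : 'I_n.+1) (phi phi1 phi2 phi3 phi4 : R -> R).
Hypotheses (ij : i != j) (sx : forall l, smooth T 4 (fun _ t => x t ord0 l))
  (dphi : forall t, I t -> [/\ has_deriv I phi t (phi1 t), has_deriv I phi1 t (phi2 t),
       has_deriv I phi2 t (phi3 t) & has_deriv I phi3 t (phi4 t)])
  (cphi4 : {within I, continuous phi4}).

Let k (e t : R) := (1 + (e * phi t) * (e * phi t) * 4^-1)^-1.

(* Rational parametrization of the rotation of angle [2 atan (e phi / 2)]. *)
Definition rotation_field l (e t : R) : R :=
  phi t * (k e t * (- (2^-1) * (e * phi t) * plane_part i j (x t) ord0 l
    + rot i j (x t) ord0 l)).

Let smooth_phi : smooth T 4 (fun _ => phi).
Proof.
have c3 : {within I, continuous phi3}.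
  by apply: (has_deriv_continuous (df := phi4)) => t /dphi[].
have c2 : {within I, continuous phi2}.
  by apply: (has_deriv_continuous (df := phi3)) => t /dphi[].
have c1 : {within I, continuous phi1}.
  by apply: (has_deriv_continuous (df := phi2)) => t /dphi[].
have c0 : {within I, continuous phi}.
  by apply: (has_deriv_continuous (df := phi1)) => t /dphi[].
apply: (smoothS T0 (dh := fun _ => phi1)) => [|_ t /dphi[]//|].
  exact: within_jointly_continuous.
apply: (smoothS T0 (dh := fun _ => phi2)) => [|_ t /dphi[]//|].
  exact: within_jointly_continuous.
apply: (smoothS T0 (dh := fun _ => phi3)) => [|_ t /dphi[]//|].
  exact: within_jointly_continuous.
apply: (smoothS T0 (dh := fun _ => phi4)) => [|_ t /dphi[]//|].
  exact: within_jointly_continuous.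
by apply: smooth0; exact: within_jointly_continuous.
Qed.

Let ephi e t := e * phi t.

Let smooth_ephi : smooth T 4 ephi.
Proof. by apply: smoothM; [exact: T0|exact: smooth_id|exact: smooth_phi]. Qed.

Let denom_gt0 e t : 0 < 1 + ephi e t * ephi e t * 4^-1.
Proof. by rewrite ltr_wpDr// mulr_ge0 ?invr_ge0// -expr2 sqr_ge0. Qed.

Let smooth_k : smooth T 4 k.
Proof.
apply: smoothV; first exact: T0.
  by move=> e t; rewrite gt_eqF// denom_gt0.
apply: smoothD; [exact: T0|exact: smooth_cst|].
by apply: smoothM; [exact: T0| |exact: smooth_cst]; apply: smoothM;
  [exact: T0|exact: smooth_ephi|exact: smooth_ephi].
Qed.

Let smooth_lin (u : E -> E) (a b : R) l i' j' :
  (forall y, u y ord0 l = a * y ord0 i' + b * y ord0 j') ->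
  smooth T 4 (fun _ t => u (x t) ord0 l).
Proof.
move=> hu; apply: (smooth_ext T0 (h := fun _ t => a * x t ord0 i' + b * x t ord0 j')).
  by move=> e t _; rewrite hu.
apply: smoothD; first exact: T0.
  by apply: smoothM; [exact: T0|exact: smooth_cst|exact: sx].
by apply: smoothM; [exact: T0|exact: smooth_cst|exact: sx].
Qed.

Let smooth_rot l : smooth T 4 (fun _ t => rot i j (x t) ord0 l).
Proof.
apply: (@smooth_lin _ ((delta_mx ord0 i : E) ord0 l) (- (delta_mx ord0 j : E) ord0 l) l j i).
by move=> y; rewrite rot_coord; ring.
Qed.

Let smooth_plane l : smooth T 4 (fun _ t => plane_part i j (x t) ord0 l).
Proof.
apply: (@smooth_lin _ ((delta_mx ord0 i : E) ord0 l) ((delta_mx ord0 j : E) ord0 l) l i j).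
by move=> y; rewrite plane_part_coord.
Qed.

Let g l (e t : R) := k e t * (- (2^-1) * (e * phi t) * plane_part i j (x t) ord0 l
    + rot i j (x t) ord0 l).

Let smooth_g l : smooth T 4 (g l).
Proof.
apply: smoothM; [exact: T0|exact: smooth_k|].
apply: smoothD; [exact: T0| |exact: smooth_rot].
apply: smoothM; [exact: T0| |exact: smooth_plane].
by apply: smoothM; [exact: T0|exact: smooth_cst|exact: smooth_ephi].
Qed.

Lemma smooth_rotation_field l : smooth T 4 (rotation_field l).
Proof. by apply: smoothM; [exact: T0|exact: smooth_phi|exact: smooth_g]. Qed.

Lemma rotation_field_sphere e t : dotp (x t) (x t) = 1 ->
  dotp (perturb x rotation_field e t) (perturb x rotation_field e t) = 1.
Proof.
move=> <-; set th := e * phi t.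
(* Here [1 + a = (1 - th ^ 2 / 4) / (1 + th ^ 2 / 4)] and [b = th / (1 + th ^ 2 / 4)], the cosine
   and sine of the angle whose half has tangent [th / 2]. *)
rewrite -[RHS](@dotp_rotation _ _ i j (x t) (- (2^-1) * th ^+ 2 * k e t) (th * k e t))//.
  suff -> : perturb x rotation_field e t = x t + - (2^-1) * th ^+ 2 * k e t
      *: plane_part i j (x t) + th * k e t *: rot i j (x t) by [].
  by apply/rowP => l; rewrite mxE /rotation_field plane_part_coord rot_coord !mxE /th; ring.
have := denom_gt0 e t; rewrite /k /ephi -/th => h.
by field; rewrite gt_eqF//; lra.
Qed.

Lemma rotation_field_zero t l e : phi t = 0 -> rotation_field l e t = 0.
Proof. by move=> p0; rewrite /rotation_field p0 mul0r. Qed.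

(** The field has [phi] as an explicit factor, so each term of the product rule contains [phi] or
    [phi1]. *)
Lemma rotation_field_derive_zero t l e : I t -> phi t = 0 -> phi1 t = 0 ->
  D (rotation_field l e) t = 0.
Proof.
move=> It p0 p1; have [d _ _ _] := dphi It; apply: has_deriv_derive => //.
apply: has_deriv_eq (has_derivM d (smooth_has_deriv T0 (smooth_g l) It)) _.
by rewrite p0 p1 !mul0r addr0.
Qed.

Lemma rotation_field_slope l : rotation_field l 0 = fun t => phi t * rot i j (x t) ord0 l.
Proof.
apply/funext => t; rewrite /rotation_field /k !mul0r addr0 invr1 mul1r.
by rewrite mulr0 mul0r add0r.
Qed.

Variables (x1 x2 : R -> E).
Hypotheses (dx : forall t, I t -> has_deriv I x t (x1 t))
  (dx1 : forall t, I t -> has_deriv I x1 t (x2 t)).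

Let has_deriv_rot (u : R -> E) (du : E) l t : has_deriv I u t du ->
  has_deriv I (fun t => rot i j (u t) ord0 l) t (rot i j du ord0 l).
Proof.
move=> /has_deriv_coordP hu; rewrite rot_coord.
rewrite (_ : (fun t => rot i j (u t) ord0 l) = (fun t => (delta_mx ord0 i : E) ord0 l
    * u t ord0 j - (delta_mx ord0 j : E) ord0 l * u t ord0 i)); last first.
  by apply/funext => s; rewrite rot_coord.
by apply: has_derivB; apply: has_derivZ.
Qed.

Lemma rotation_slope0 t : Qrow T rotation_field 0 0 t = phi t *: rot i j (x t).
Proof. by apply/rowP => l; rewrite !mxE /= rotation_field_slope rot_coord !mxE; ring. Qed.

Let slope1 l t : I t -> D (rotation_field l 0) t
  = phi1 t * rot i j (x t) ord0 l + phi t * rot i j (x1 t) ord0 l.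
Proof.
move=> It; have [d _ _ _] := dphi It; apply: has_deriv_derive => //.
by rewrite rotation_field_slope; apply: has_derivM => //; apply: has_deriv_rot; exact: dx.
Qed.

Lemma rotation_slope1 t : I t -> Qrow T rotation_field 1 0 t =
  phi1 t *: rot i j (x t) + phi t *: rot i j (x1 t).
Proof. by move=> It; apply/rowP => l; rewrite mxE /= slope1// !rot_coord !mxE; ring. Qed.

Lemma rotation_slope2 t : I t -> Qrow T rotation_field 2 0 t =
  phi2 t *: rot i j (x t) + (2 * phi1 t) *: rot i j (x1 t) + phi t *: rot i j (x2 t).
Proof.
move=> It; apply/rowP => l; rewrite mxE /=; have [d d1 _ _] := dphi It.
apply: has_deriv_derive => //.
apply: (@has_deriv_ext _ _ I (fun t => phi1 t * rot i j (x t) ord0 l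
    + phi t * rot i j (x1 t) ord0 l)) => //.
  by move=> s; rewrite inE => Is; rewrite slope1.
apply: has_deriv_eq (has_derivD
  (has_derivM d1 (@has_deriv_rot _ _ l _ (dx It))) (has_derivM d (@has_deriv_rot _ _ l _
      (dx1 It)))) _.
by rewrite !rot_coord !mxE; ring.
Qed.

End RotationVariation.

(** * From brackets to the Euler-Lagrange equation *)

Section EulerLagrange.
Context {R : realType} {n : nat}.
Notation E := 'rV[R]_n.+1.

(** Vanishing brackets make [V] parallel to the unit vector [x], and orthogonality removes the
    multiple. This is why rotations in coordinate planes are enough variations. *)
Lemma vector_eq0 (V x : E) : dotp x x = 1 -> dotp V x = 0 ->
  (forall i j, bracket i j V x = 0) -> V = 0.
Proof.
move=> xx Vx br; apply/rowP => i; rewrite mxE.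
have -> : V ord0 i = \sum_j V ord0 i * (x ord0 j * x ord0 j).
  by rewrite -mulr_sumr -/(dotp x x) xx mulr1.
rewrite (eq_bigr (fun j => x ord0 i * (V ord0 j * x ord0 j))).
  by rewrite -mulr_sumr -/(dotp V x) Vx mulr0.
by move=> j _; have := br i j; rewrite /bracket => /eqP; rewrite subr_eq0 => /eqP h;
  rewrite mulrA h; ring.
Qed.

(** The derivative of [[dpw, x]] that results from solving [C' = B - A1] for this bracket and
    differentiating; the factor [lam] cancels. The letters [px], [pv], [pw], [pz] stand for the
    partial derivatives of [L], and a prefix [d] for their time derivatives. *)
Definition bracket_slope i j (x x1 x2 px pv pw dpv dpw : E) (pz dpz : R) : R :=
  bracket i j dpw x1 + 2 * pz * bracket i j dpw x + dpz * bracket i j pw x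
  - pz ^+ 2 * bracket i j pw x - pz * bracket i j pv x
  + 2 * pz * bracket i j x x1 * dotp pw x + bracket i j dpv x
  - 2 * bracket i j x x2 * dotp pw x
  - 2 * bracket i j x x1 * (dotp dpw x + dotp pw x1)
  - bracket i j px x + dotp x2 x * bracket i j pw x.

(** Algebra at a single time, where [W] is the time derivative of [dpw - dotp dpw x *: x]. The
    bracket of the whole expression with [x] is the difference of the two sides of the
    hypothesis. *)
Lemma euler_lagrange_of_brackets (x x1 x2 px pv pw dpv dpw W : E) (pz dpz : R) :
  dotp x x = 1 -> dotp x1 x = 0 ->
  (forall i j, bracket i j W x + bracket i j (dpw - dotp dpw x *: x) x1
     = bracket_slope i j x x1 x2 px pv pw dpv dpw pz dpz) ->
  (W - dotp W x *: x) - (dpv - dotp dpv x *: x) - dotp px x *: x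
  - dotp x2 x *: pw - (2 * dotp pw x1) *: x1 - (2 * dotp pw x) *: x2 + px
  - dotp dpw x *: x1 + (3 * dotp pw x * dotp x2 x) *: x
  + pz ^+ 2 *: (pw - dotp pw x *: x)
  - ((dpz *: pw + pz *: dpw) - dotp (dpz *: pw + pz *: dpw) x *: x)
  - pz *: ((dpw - dotp dpw x *: x) - pv + dotp pv x *: x - (2 * dotp pw x) *: x1) = 0.
Proof.
move=> xx x1x br; apply: (vector_eq0 xx).
  do ![rewrite dotpBl | rewrite dotpDl | rewrite dotpZl]; rewrite xx x1x; ring.
move=> i j; have := br i j; move/eqP; rewrite -subr_eq0 => /eqP <-.
by rewrite /bracket_slope /bracket !mxE; ring.
Qed.

Variables (T : R) (T0 : 0 < T).
Local Notation I := (`[0, T]%classic : set R).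
Local Notation D := (derive_along I).
Variables (L : lagrangian R n) (z0 : R) (x0 xT v0 vT : E) (x : R -> E) (z : R -> R).
Hypotheses (LC1 : C1_lagrangian T L)
  (sol : herglotz_solution T L z0 x0 xT v0 vT x z)
  (dL : partials_derivable_along T L x z).

Let x1 := D x.
Let x2 := D x1.
Let px := along T (L_x L) x z.
Let pv := along T (L_v L) x z.
Let pw := along T (L_w L) x z.
Let pz := along T (L_z L) x z.

Let dx t : I t -> has_deriv I x t (x1 t).
Proof. move=> It; exact: (derivable_has_deriv T0 It ((adm_C4 sol.1).1 0%N t isT It)). Qed.

Let dx1 t : I t -> has_deriv I x1 t (x2 t).
Proof. move=> It; exact: (derivable_has_deriv T0 It ((adm_C4 sol.1).1 1%N t isT It)). Qed.

Let dx2 t : I t -> has_deriv I x2 t (D x2 t).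
Proof. move=> It; exact: (derivable_has_deriv T0 It ((adm_C4 sol.1).1 2%N t isT It)). Qed.

Let dpx t : I t -> has_deriv I px t (D px t).
Proof. move=> It; have [e1 e2 e3 e4] := dL It; exact: (derivable_has_deriv T0 It e1). Qed.

Let dpv t : I t -> has_deriv I pv t (D pv t).
Proof. move=> It; have [e1 e2 e3 e4] := dL It; exact: (derivable_has_deriv T0 It e2). Qed.

Let dpw t : I t -> has_deriv I pw t (D pw t).
Proof. move=> It; have [e1 e2 e3 e4] := dL It; exact: (derivable_has_deriv T0 It e3). Qed.

Let dpz t : I t -> has_deriv I pz t (D pz t).
Proof. move=> It; have [e1 e2 e3 e4] := dL It; exact: (derivable_has_deriv T0 It e4). Qed.

Let xx t : I t -> dotp (x t) (x t) = 1.
Proof. exact: (adm_sphere sol.1). Qed.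

Let x1x t : I t -> dotp (x1 t) (x t) = 0.
Proof.
move=> It; have h0 : has_deriv I (fun s => dotp (x s) (x s)) t 0.
  apply: (has_deriv_ext It _ (has_deriv_cst I 1 t)) => s.
  by rewrite inE => Is; rewrite xx.
have := has_deriv_uniq T0 It (has_deriv_dotp (dx It) (dx It)) h0.
by rewrite (dotpC (x t)) => h; lra.
Qed.

(** [A], [B], [C] are the coefficients of [phi], [phi1], [phi2] in the integrand given by a
    rotation. Antisymmetry of [rot] cancels the terms in [dotp (pw t) (x t)] from [A]; the one in
    [B] comes from the velocity part of the second derivative of the field. *)
Let A (lam : R -> R) (i j : 'I_n.+1) (t : R) : R := lam t * (bracket i j (px t) (x t) +
    bracket i j (pv t) (x1 t)
  + bracket i j (pw t) (x2 t) - dotp (x2 t) (x t) * bracket i j (pw t) (x t)).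
Let B (lam : R -> R) (i j : 'I_n.+1) (t : R) : R := lam t * (bracket i j (pv t) (x t) + 2
    * bracket i j (pw t) (x1 t)
  - 2 * (bracket i j (x t) (x1 t) * dotp (pw t) (x t))).
Let C (lam : R -> R) (i j : 'I_n.+1) (t : R) : R := lam t * bracket i j (pw t) (x t).

(** [C] is already differentiable by hypothesis. The gain is the value of its derivative, [B - A1],
    which is differentiable again. *)
Lemma bracket_first_integral (lam : R -> R) i j : i != j -> (forall t, 0 < lam t) ->
  (forall t, I t -> has_deriv I lam t (- pz t * lam t)) ->
  exists A1 : R -> R, forall t, I t -> has_deriv I A1 t (A lam i j t) /\
    has_deriv I (C lam i j) t (B lam i j t - A1 t).
Proof.
move=> ij lam0 dlam.
have dd (V : normedModType R) (f df : R -> V) :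
    (forall t, I t -> has_deriv I f t (df t)) -> differentiable_on T f.
  by move=> hf t It; exact: has_deriv_derivable (hf t It).
have ex := dd _ _ _ dx; have ex1 := dd _ _ _ dx1; have ex2 := dd _ _ _ dx2.
have epx := dd _ _ _ dpx; have epv := dd _ _ _ dpv; have epw := dd _ _ _ dpw.
have elam := dd _ _ _ dlam.
have ebr u v : differentiable_on T u -> differentiable_on T v ->
  differentiable_on T (fun t => bracket i j (u t) (v t)) := @differentiable_bracket R n T
      T0 i j u v.
have edot u v : differentiable_on T u -> differentiable_on T v ->
  differentiable_on T (fun t => dotp (u t) (v t)) := @differentiable_dotp R n T T0 u v.
have e2 := @differentiable_on_cst R T 2.
have eM := @differentiable_onM R T T0; have eB := @differentiable_onB R T T0.
have eD := @differentiable_onD R T T0.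
have cont f : differentiable_on T f -> {within I, continuous f} :=
  @differentiable_continuous_on R T T0 f.
have cA : {within I, continuous (A lam i j)}.
  apply/cont/(eM _ _ elam)/(eB _ _ _ (eM _ _ (edot _ _ ex2 ex) (ebr _ _ epw ex))).
  exact: (eD _ _ (eD _ _ (ebr _ _ epx ex) (ebr _ _ epv ex1)) (ebr _ _ epw ex2)).
have cB : {within I, continuous (B lam i j)}.
  apply/cont/(eM _ _ elam).
  exact: (eB _ _ (eD _ _ (ebr _ _ epv ex) (eM _ _ e2 (ebr _ _ epw ex1)))
    (eM _ _ e2 (eM _ _ (ebr _ _ ex ex1) (edot _ _ epw ex)))).
have cC : {within I, continuous (C lam i j)}.
  by apply: cont; exact: (eM _ _ elam (ebr _ _ epw ex)).
apply: (du_bois_reymond2 T0 cA cB cC).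
move=> phi phi1 phi2 phi3 phi4 N dphi cphi4 [p0 pT p10 p1T] N0 dN.
have sx := solution_smooth T0 sol.
apply: (variation_stationary T0 LC1 sol (Q := rotation_field x i j phi) (lam := lam)).
- move=> l; exact: (smooth_rotation_field T0 i j sx dphi cphi4).
- by move=> e t It; apply: rotation_field_sphere => //; exact: xx.
- move=> e l; split.
  + exact: rotation_field_zero.
  + exact: rotation_field_zero.
  + exact: (rotation_field_derive_zero T0 _ _ sx dphi cphi4 _ _ (itv0 T0)).
  + exact: (rotation_field_derive_zero T0 _ _ sx dphi cphi4 _ _ (itvT T0)).
- by move=> t _.
- exact: dlam.
- exact: N0.
move=> t It; apply: has_deriv_eq (dN t It) _.
rewrite rotation_slope0 (rotation_slope1 T0 i j dphi dx It).
rewrite (rotation_slope2 T0 i j dphi dx dx1 It).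
rewrite -/x1 -/x2 -/px -/pv -/pw /A /B /C.
move: (px t) (pv t) (pw t) (x t) (x1 t) (x2 t) => a1 a2 a3 y y1 y2.
rewrite !(dotp_rotl, dotpDl, dotpZl).
rewrite !dotpB !(dotp_rot, dotpD, dotpZ) /bracket; ring.
Qed.

(** Solving [C' = B - A1] for [[D pw, x]] expresses it through differentiable functions, although
    nothing is assumed on the differentiability of [D pw]. *)
Lemma bracket_has_deriv i j t : I t ->
  has_deriv I (fun s => bracket i j (D pw s) (x s)) t
    (bracket_slope i j (x t) (x1 t) (x2 t) (px t) (pv t) (pw t) (D pv t) (D pw t)
      (pz t) (D pz t)).
Proof.
(* For [i = j] there is no rotation plane, but bracket and slope both vanish identically. *)
move=> It; have [<-|ij] := eqVneq i j.
  apply: (@has_deriv_ext _ _ I (fun=> 0)); first exact: It.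
    by move=> s _; rewrite /bracket subrr.
  apply: has_deriv_eq (has_deriv_cst _ _ _) _.
  move: (px t) (pv t) (pw t) (x t) (x1 t) (x2 t) (D pw t) (D pv t) (pz t) (D pz t) => *.
  by rewrite /bracket_slope /bracket; ring.
have cpz : continuous (fun t => - pz (clamp T t)).
  move=> s; apply: cvgN; apply: (clamped_continuous T0).
  by apply: has_deriv_continuous dpz.
have [lam [lam0 dlam']] := integrating_factor T cpz.
have dlam s : I s -> has_deriv I lam s (- pz s * lam s).
  by move=> Is; have := dlam' s Is; rewrite (clamp_id Is).
have [A1 hA1] := bracket_first_integral ij lam0 dlam.
have lamN0 s : lam s != 0 by rewrite gt_eqF.
(* The two expressions for [C'] are compared: [B - A1], and the product rule with
   [lam' = - pz * lam]. *)
have CE s : I s -> B lam i j s - A1 s = lam s * (bracket i j (D pw s) (x s)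
    + bracket i j (pw s) (x1 s) - pz s * bracket i j (pw s) (x s)).
  move=> Is; have [_ dC] := hA1 s Is.
  rewrite (has_deriv_uniq T0 Is dC (has_derivM (dlam s Is)
    (@has_deriv_bracket _ _ _ i j _ _ _ _ _ (dpw Is) (dx Is)))).
  move: (bracket _ _ (pw s) (x s)) (bracket _ _ (pw s) (x1 s)) (bracket _ _ (D pw s) _).
  by move: (pz s) (lam s) => *; ring.
apply: (@has_deriv_ext _ _ I (fun s => (lam s)^-1 * (B lam i j s - A1 s)
    - bracket i j (pw s) (x1 s) + pz s * bracket i j (pw s) (x s))).
- exact: It.
- by move=> s; rewrite inE => Is; rewrite (CE _ Is) (mulKf (lamN0 s)); move: (bracket _ _
    (pw s) (x s)) (bracket _ _ (pw s) (x1 s)) => *; ring.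
have dB := has_derivM (dlam t It) (has_derivB
  (has_derivD (@has_deriv_bracket _ _ _ i j _ _ _ _ _ (dpv It) (dx It))
    (@has_derivZ _ _ _ 2 _ _ (@has_deriv_bracket _ _ _ i j _ _ _ _ _ (dpw It) (dx1 It))))
  (@has_derivZ _ _ _ 2 _ _ (has_derivM (@has_deriv_bracket _ _ _ i j _ _ _ _ _ (dx It) (dx1 It))
    (has_deriv_dotp (dpw It) (dx It))))).
have dlamV : has_deriv I (fun s => (lam s)^-1) t (- (- pz t * lam t) / lam t ^+ 2).
  by apply: (has_derivV It _ (dlam t It)) => s _; exact: lamN0.
apply: has_deriv_eq.
  exact: (has_derivD (has_derivB (has_derivM dlamV (has_derivB dB (hA1 t It).1))
    (@has_deriv_bracket _ _ _ i j _ _ _ _ _ (dpw It) (dx1 It)))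
    (has_derivM (dpz It) (@has_deriv_bracket _ _ _ i j _ _ _ _ _ (dpw It) (dx It)))).
rewrite /= (CE _ It) /A /bracket_slope.
move: (px t) (pv t) (pw t) (x t) (x1 t) (x2 t) (D pw t) (D pv t) (pz t) (D pz t)
  (lam t) (lamN0 t) => a1 a2 a3 y y1 y2 b3 b2 c dc l l0.
by rewrite /bracket; field.
Qed.

Let V := covD I x pw.

Let V_bracket s i j : bracket i j (V s) (x s) = bracket i j (D pw s) (x s).
Proof.
rewrite (_ : V s = D pw s - dotp (D pw s) (x s) *: x s)//; move: (D pw s) => d.
by rewrite /bracket !mxE; ring.
Qed.

(** Since [|x| = 1], contracting the brackets with [x] returns the tangential part of [D pw], which
    thus inherits the differentiability of the brackets. *)
Let V_coord s i : I s ->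
  V s ord0 i = \sum_j bracket i j (D pw s) (x s) * x s ord0 j.
Proof.
move=> Is; rewrite (_ : V s = D pw s - dotp (D pw s) (x s) *: x s)//; move: (D pw s) => d.
rewrite !mxE.
rewrite (eq_bigr (fun j => d ord0 i * (x s ord0 j * x s ord0 j)
  - d ord0 j * x s ord0 j * x s ord0 i)); last first.
  by move=> j _; rewrite /bracket; ring.
by rewrite sumrB -mulr_sumr -mulr_suml -!/(dotp _ _) xx// mulr1.
Qed.

Lemma covD_derivable t : I t -> derivable_along I V t.
Proof.
move=> It.
suff /has_deriv_derivable : has_deriv I V t (\row_i \sum_j
    (bracket_slope i j (x t) (x1 t) (x2 t) (px t) (pv t) (pw t) (D pv t) (D pw t)
      (pz t) (D pz t) * x t ord0 j + bracket i j (D pw t) (x t) * x1 t ord0 j)) by [].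
apply/has_deriv_coordP => i; rewrite mxE.
apply: (@has_deriv_ext _ _ I
  (fun s => \sum_j bracket i j (D pw s) (x s) * x s ord0 j)).
- exact: It.
- by move=> s; rewrite inE => Is; rewrite V_coord.
apply: has_deriv_sum => j; apply: has_derivM; first exact: bracket_has_deriv.
by have /has_deriv_coordP := dx It; exact.
Qed.

(** [[V, x]] and [[D pw, x]] are the same function; its derivative is computed once by the product
    rule and once by [bracket_has_deriv]. *)
Lemma covD_bracket i j t : I t ->
  bracket i j (D V t) (x t) + bracket i j (D pw t - dotp (D pw t) (x t) *: x t) (x1 t)
  = bracket_slope i j (x t) (x1 t) (x2 t) (px t) (pv t) (pw t) (D pv t) (D pw t)
      (pz t) (D pz t).
Proof.
move=> It; have dV := derivable_has_deriv T0 It (covD_derivable It).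
apply: (has_deriv_uniq T0 It (@has_deriv_bracket _ _ _ i j _ _ _ _ _ dV (dx It))).
apply: (@has_deriv_ext _ _ I (fun s => bracket i j (D pw s) (x s))).
- exact: It.
- by move=> s _; rewrite V_bracket.
exact: bracket_has_deriv.
Qed.

(** The derivability conjunct ensures that the iterated covariant derivative in the equation is a
    genuine limit and not the default value of [lim]. *)
Lemma herglotz_euler_lagrange t : I t ->
  derivable_along I (covD I x pw) t /\
  covD I x (covD I x pw) t - covD I x pv t
  - dotp (px t) (x t) *: x t - dotp (x2 t) (x t) *: pw t
  - (2 * dotp (pw t) (x1 t)) *: x1 t - (2 * dotp (pw t) (x t)) *: x2 t
  + px t - dotp (D pw t) (x t) *: x1 t
  + (3 * dotp (pw t) (x t) * dotp (x2 t) (x t)) *: x t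
  + (pz t) ^+ 2 *: (pw t - dotp (pw t) (x t) *: x t)
  - covD I x (fun s => pz s *: pw s) t
  - pz t *: (covD I x pw t - pv t + dotp (pv t) (x t) *: x t
             - (2 * dotp (pw t) (x t)) *: x1 t) = 0.
Proof.
move=> It; split; first exact: covD_derivable.
have dzw : D (fun s => pz s *: pw s) t = D pz t *: pw t + pz t *: D pw t.
  apply: (has_deriv_derive T0 It); apply/has_deriv_coordP => i.
  have fE : (fun s => (pz s *: pw s) ord0 i) = (fun s => pz s * pw s ord0 i).
    by apply/funext => s; move: (pw s) => w; rewrite mxE.
  rewrite fE.
  apply: has_deriv_eq (has_derivM (dpz It) ((has_deriv_coordP _ _ _ _).1 (dpw It) i)) _.
  by move: (D pz t) (D pw t) (pz t) (pw t) => c v d w; rewrite !mxE.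
have := @euler_lagrange_of_brackets (x t) (x1 t) (x2 t) (px t) (pv t) (pw t) (D pv t)
  (D pw t) (D V t) (pz t) (D pz t) (xx It) (x1x It) (fun i j => @covD_bracket i j t It).
by rewrite -dzw.
Qed.

End EulerLagrange.

Theorem theorem3p1 (R : realType) (n : nat) (T z0 : R)
  (x0 xT v0 vT : 'rV[R]_n.+1) (L : lagrangian R n)
  (x : R -> 'rV[R]_n.+1) (z : R -> R) :
  (1 <= n)%N -> 0 < T ->
  sphere x0 -> sphere xT -> tangent x0 v0 -> tangent xT vT ->
  standing_hypotheses T L z0 x0 xT v0 vT ->
  herglotz_solution T L z0 x0 xT v0 vT x z ->
  let I : set R := `[0, T]%classic in
  let dx := derive_along I x in
  let ddx := derive_along I dx in
  let Lx := along T (L_x L) x z in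
  let Lv := along T (L_v L) x z in
  let Lw := along T (L_w L) x z in
  let Lz := along T (L_z L) x z in
  forall t : R, I t ->
  derivable_along I (covD I x Lw) t /\
  covD I x (covD I x Lw) t - covD I x Lv t
  - dotp (Lx t) (x t) *: x t - dotp (ddx t) (x t) *: Lw t
  - (2 * dotp (Lw t) (dx t)) *: dx t - (2 * dotp (Lw t) (x t)) *: ddx t
  + Lx t - dotp (derive_along I Lw t) (x t) *: dx t
  + (3 * dotp (Lw t) (x t) * dotp (ddx t) (x t)) *: x t
  + (Lz t) ^+ 2 *: (Lw t - dotp (Lw t) (x t) *: x t)
  - covD I x (fun s => Lz s *: Lw s) t
  - Lz t *: (covD I x Lw t - Lv t + dotp (Lv t) (x t) *: x t
             - (2 * dotp (Lw t) (x t)) *: dx t) = 0.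
Proof.
move=> _ T0 _ _ _ _ [LC1 dL] sol I dx ddx Lx Lv Lw Lz t It.
exact: (herglotz_euler_lagrange T0 LC1 sol (dL x z sol.1) It).
Qed.
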